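(* Let $m\ge1$, $0\le s\le m$, $I\subset\{0,\dots,m\}$ nonempty, and $\mu=(2^{(s)},1^{(2m-2s)},0^{(s)})\in X_*$. For $\tilde w\in\widetilde W/W_I$, $\tilde w$ is wedge-permissible if and only if $\tilde w$ is $\mu$-admissible in $\widetilde W/W_I$.
   Context: Notation: $(x^{(p)},y^{(q)},\dots)$ denotes $x$ repeated $p$ times, then $y$ repeated $q$ times, etc.; $\mathbf d=(d,\dots,d)$; for vectors $v\ge w$ means entrywise. Let $X_*=\{x\in\mathbb Z^{2m}: x_1+x_{2m}=x_2+x_{2m-1}=\dots=x_m+x_{m+1}\}$ and $V=X_*\otimes\mathbb R\subset\mathbb R^{2m}$. Put $j^*=2m+1-j$ and $S_{2m}^*=\{\sigma\in S_{2m}:\sigma(j^* )=\sigma(j)^*\ \forall j\}$. Let $\widetilde W=X_*\rtimes S_{2m}^*$, acting on $\mathbb R^{2m}$ by affine transformations ($t_\lambda\sigma: x\mapsto\lambda+\sigma x$, where $S_{2m}$ permutes coordinates). The affine root hyperplanes in $V$ are the zero loci of $x\mapsto x_i-x_j-k$ for $1\le i<j\le 2m$, $k\in\mathbb Z$; the affine Weyl group $W_a\subset\widetilde W$ is the subgroup generated by the affine reflections of $V$ (lying in $\widetilde W$) across these hyperplanes. Take as base alcove $A=\{x\in V: x_{2m}-1<x_1<x_2<\dots<x_m<x_{m+1}\}$, let $\Omega$ be its stabilizer in $\widetilde W$, so $\widetilde W=W_a\rtimes\Omega$; $W_a$ is a Coxeter group generated by the reflections across the walls of $A$, with Bruhat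 order $\le$, extended to $\widetilde W$ by: $x\omega\le x'\omega'$ ($x,x'\in W_a$, $\omega,\omega'\in\Omega$) iff $\omega=\omega'$ and $x\le x'$. For $i=2mb+c$, $0\le c<2m$, put $\omega_i=((-1)^{(c)},0^{(2m-c)})-\mathbf b$. Let $W_I$ be the stabilizer in $\widetilde W$ of all $\omega_i$, $i\in2m\mathbb Z\pm I$ (integers congruent mod $2m$ to an element of $I\cup(-I)$). The Bruhat order on $\widetilde W/W_I$ is defined by comparing the unique minimal-length representatives of cosets. For $\lambda\in X_*$ let $t_\lambda$ be the translation element. A coset $\tilde w\in\widetilde W/W_I$ is $\mu$-admissible if there is $\sigma\in S^*_{2m}$ with $\tilde w\le t_{\sigma\mu}W_I$. It is wedge-permissible if for all $i\in2m\mathbb Z\pm I$: (P'1) $\mathbf 0\le\tilde w\cdot\omega_i-\omega_i\le\mathbf 2$; (P'2) the entries of $\tilde w\cdot\omega_i-\omega_i$ sum to $2m$; (P'3) $\#\{j:(\tilde w\cdot\omega_i-\omega_i)(j)=0\}\le s$. (These conditions do not depend on the coset representative.) *)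

(* Defs.v *)
(* Conventions: indices are 0-based, j : 'I_(m.*2) stands for
   coordinate j+1 of the paper; j* = 2m+1-j becomes rev_ord j. *)
From HB Require Import structures.
From mathcomp Require Import all_boot all_order all_algebra all_fingroup.
From Stdlib Require Import Relations.
Set Implicit Arguments. Unset Strict Implicit. Unset Printing Implicit Defensive.
Import Order.TTheory GRing.Theory Num.Theory.
Local Open Scope ring_scope.

Section Defs.
Variable m : nat.
Local Notation n := (m.*2).
Local Notation I2 := 'I_n.

Definition star (j : I2) : I2 := rev_ord j.

(* Elements t_lam sigma of X_* x| S_2m^* : pairs (lam, sigma); sigma permutes
   coordinates: (sigma x)_i = x_(sigma^-1 i). *)
Definition ew : Type := ({ffun I2 -> int} * {perm I2})%type.

Definition inXstar (lam : I2 -> int) : Prop :=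
  forall j k : I2, lam j + lam (star j) = lam k + lam (star k).
Definition inSstar (s : {perm I2}) : Prop :=
  forall j : I2, s (star j) = star (s j).
Definition inW (w : ew) : Prop := inXstar w.1 /\ inSstar w.2.

(* affine action x |-> lam + sigma x on R^n-valued vectors, R a ring
   (used with R = rat for points of V and with R = int for the omega_i) *)
Definition act {R : pzRingType} (w : ew) (x : I2 -> R) : I2 -> R :=
  fun i => (w.1 i)%:~R + x ((w.2)^-1%g i).

(* group law, so that act (ewmul w w') = act w \o act w' *)
Definition ewmul (w w' : ew) : ew :=
  ([ffun i => w.1 i + w'.1 ((w.2)^-1%g i)], (w'.2 * w.2)%g).
Definition ew1 : ew := ([ffun => 0], 1%g).
Definition ewprod (ts : seq ew) : ew := foldr ewmul ew1 ts.

Definition inV (x : I2 -> rat) : Prop :=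
  forall j k : I2, x j + x (star j) = x k + x (star k).
Definition inA (x : I2 -> rat) : Prop :=
  inV x /\
  (forall f l : I2, val f = 0%N -> val l = n.-1 -> x l - 1 < x f) /\
  (forall j j' : I2, (val j < m)%N -> val j' = (val j).+1 -> x j < x j').

(* w is the reflection of V across the affine root hyperplane x_i - x_j = k
   (an element of W~, non-trivial, fixing the hyperplane pointwise) *)
Definition reflH (i j : I2) (k : int) (w : ew) : Prop :=
  inW w /\ w <> ew1 /\
  forall x : I2 -> rat, inV x -> x i - x j = k%:~R -> forall l, act w x l = x l.

Definition is_refl (w : ew) : Prop :=
  exists (i j : I2) (k : int), (val i < val j)%N /\ reflH i j k w.

Definition wall (i j : I2) (k : int) : Prop :=
  ((val i < m)%N /\ val j = (val i).+1 /\ k = 0) \/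
  (val i = 0%N /\ val j = n.-1 /\ k = -1).
Definition is_simple (w : ew) : Prop :=
  exists (i j : I2) (k : int), wall i j k /\ reflH i j k w.

Definition inWa (w : ew) : Prop :=
  exists ts : seq ew, (forall t, t \in ts -> is_refl t) /\ w = ewprod ts.

Definition inOmega (w : ew) : Prop :=
  inW w /\ forall x : I2 -> rat, inA x <-> inA (act w x).

Definition lenle (w : ew) (k : nat) : Prop :=
  exists ss : seq ew, (size ss <= k)%N /\ (forall s, s \in ss -> is_simple s) /\
  exists o, inOmega o /\ w = ewmul (ewprod ss) o.
Definition len_lt (w w' : ew) : Prop := exists k, lenle w k /\ ~ lenle w' k.

Definition bstep (x y : ew) : Prop :=
  exists t, is_refl t /\ y = ewmul x t /\ len_lt x y.
Definition bruhat_a (x y : ew) : Prop :=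
  inWa x /\ inWa y /\ clos_refl_trans ew bstep x y.
Definition bruhat (w w' : ew) : Prop :=
  exists x x' o, inWa x /\ inWa x' /\ inOmega o /\
    w = ewmul x o /\ w' = ewmul x' o /\ bruhat_a x x'.

Definition omega (i : int) : I2 -> int :=
  fun j => (if (Posz (val j) < (i %% (n : int))%Z) then -1 else 0) - (i %/ (n : int))%Z.

Definition inI2m (I : {set 'I_m.+1}) (i : int) : Prop :=
  exists a, a \in I /\
   ((i = (val a : int) %[mod (n : int)])%Z \/ (i = - (val a : int) %[mod (n : int)])%Z).

Definition inWI (I : {set 'I_m.+1}) (w : ew) : Prop :=
  inW w /\ forall i, inI2m I i -> forall j, act w (omega i) j = omega i j.

Definition incoset (I : {set 'I_m.+1}) (w u : ew) : Prop :=
  exists v, inWI I v /\ u = ewmul w v.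
Definition minrep (I : {set 'I_m.+1}) (w u : ew) : Prop :=
  incoset I w u /\ forall v, incoset I w v -> forall k, lenle v k -> lenle u k.
Definition coset_le (I : {set 'I_m.+1}) (w w' : ew) : Prop :=
  exists u u', minrep I w u /\ minrep I w' u' /\ bruhat u u'.

Definition mu (s : nat) : I2 -> int :=
  fun j => if (val j < s)%N then 2 else if (val j < n - s)%N then 1 else 0.
Definition trans (lam : I2 -> int) : ew := ([ffun j => lam j], 1%g).
Definition permvec (sg : {perm I2}) (lam : I2 -> int) : I2 -> int :=
  fun j => lam (sg^-1%g j).

Definition admissible (s : nat) (I : {set 'I_m.+1}) (w : ew) : Prop :=
  exists sg : {perm I2}, inSstar sg /\ coset_le I w (trans (permvec sg (mu s))).

Definition wedge_permissible (s : nat) (I : {set 'I_m.+1}) (w : ew) : Prop :=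
  forall i, inI2m I i ->
    let d := fun j => act w (omega i) j - omega i j in
    (forall j, 0 <= d j <= 2) /\
    \sum_(j : I2) d j = (n : int) /\
    (#|[set j : I2 | d j == 0]| <= s)%N.

End Defs.

(* Main.v *)
(** An element of the extended affine Weyl group is encoded by a bijection [U] of the integers
    commuting with [t |-> t + 2m] and, up to a constant, with [t |-> -1 - t]. Reflections become
    (doubled) affine transpositions, and multiplying by a reflection goes up in the Bruhat order iff
    it exchanges two values of [U] that are in increasing order.

    Admissible elements are permissible because going down by a reflection replaces the vectors
    [w omega_i - omega_i] by more balanced ones. Conversely, a permissible coset has a
    representative that is permissible at every [i]: take one minimizing a quadratic spread at a
    missing index [i0], and add the indices one by one. A representative permissible at every
    [i] is then raised by reflections within the permissible set until it is a translation by a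
    conjugate of [mu]. With [V = U - 2m], permissibility says that [|V t - t| <= 2m] and that
    [N i], the number of intervals [(t, V t]] containing [i], is at most [s]. Two crossing
    intervals can be exchanged without changing [N]. If there is no crossing and
    [t < V t < t + 2m] for some [t], let [x] be the last integer before [t] with [N x >= N (t + 1)];
    exchanging [x] and [t] raises [N] by one on [(x, t]], where it was smaller than [N (t + 1)]. Otherwise
    [V t] is congruent to [t] for all [t], and one may exchange a fixed point with its mirror
    image as long as [N < s]. Finally, comparison in the Bruhat order passes to minimal coset
    representatives by the lifting property. *)

Require Import Defs.
From mathcomp Require Import all_boot all_order all_algebra all_fingroup.
From mathcomp Require Import zify ring lra.
From Stdlib Require Import Relations Classical.
Set Implicit Arguments. Unset Strict Implicit. Unset Printing Implicit Defensive.
Import Order.TTheory GRing.Theory Num.Theory.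
Local Open Scope ring_scope.

(** * Floors, congruences and residues modulo [n] *)

Section Line.
Variable m : nat.
Hypothesis Hm : (0 < m)%N.
Local Notation n := (Posz m.*2).
Local Notation I2 := 'I_(m.*2).
Implicit Types (t a b c i q : int) (w z : ew m).

Lemma n_gt0 : 0 < n. Proof. lia. Qed.
Lemma n_neq0 : n != 0. Proof. lia. Qed.

(** On [[0, n)] this function of [t] is the vector [omega i]. For [a <= b], equality of [fl i a] and
    [fl i b] means that no translate of [i] by a multiple of [n] lies in [(a, b]]. *)
Definition fl i t : int := ((t - i) %/ n)%Z.

Lemma fl_ge i t q : (q <= fl i t) = (i + q * n <= t).
Proof. by rewrite /fl lez_divRL ?n_gt0 //; lia. Qed.

Lemma fl_bounds i t : i + fl i t * n <= t /\ t < i + (fl i t + 1) * n.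
Proof.
have h1 := fl_ge i t (fl i t); have h2 := fl_ge i t (fl i t + 1).
by split; lia.
Qed.

Lemma fl_uniq i t q : i + q * n <= t -> t < i + (q + 1) * n -> fl i t = q.
Proof. by move=> h1 h2; have := fl_ge i t q; have := fl_ge i t (q + 1); lia. Qed.

Lemma fl_mono i a b : a <= b -> fl i a <= fl i b.
Proof. by move=> h; rewrite fl_ge; have := fl_bounds i a; lia. Qed.

Lemma fl_lt i a b : fl i a < fl i b -> a < b.
Proof. by move=> h; case: (ltP a b) => // /(fl_mono i); lia. Qed.

Lemma fl_per i t q : fl i (t + q * n) = fl i t + q.
Proof. by have := fl_bounds i t => -[h1 h2]; apply: fl_uniq; lia. Qed.

Lemma fl_peri i t q : fl (i + q * n) t = fl i t - q.
Proof. by have := fl_bounds i t => -[h1 h2]; apply: fl_uniq; lia. Qed.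

Lemma fl_star i t : fl (- i) (-1 - t) = - 1 - fl i t.
Proof. by have := fl_bounds i t => -[h1 h2]; apply: fl_uniq; lia. Qed.

Definition eqm a b := (n %| a - b)%Z.

Lemma eqmP a b : reflect (exists q, a = b + q * n) (eqm a b).
Proof.
by apply: (iffP dvdzP) => -[q hq]; exists q; lia.
Qed.

Lemma eqm_shift a q : eqm (a + q * n) a.
Proof. by apply/eqmP; exists q. Qed.

Lemma eqmxx a : eqm a a.
Proof. by apply/eqmP; exists 0; lia. Qed.

Lemma eqmC a b : eqm a b = eqm b a.
Proof. by apply/eqmP/eqmP => -[q ->]; exists (- q); lia. Qed.

Lemma eqm_trans a b c : eqm a b -> eqm b c -> eqm a c.
Proof. by move=> /eqmP[q ->] /eqmP[q' ->]; apply/eqmP; exists (q + q'); lia. Qed.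

Lemma eqm_l a b c : eqm a b -> eqm a c = eqm b c.
Proof.
move=> h; apply/idP/idP; last exact: eqm_trans.
by apply: eqm_trans; rewrite eqmC.
Qed.

Lemma eqm_star a b : eqm (-1 - a) (-1 - b) = eqm a b.
Proof. by apply/eqmP/eqmP => -[q h]; exists (- q); lia. Qed.

Lemma eqm_starl a b : eqm (-1 - a) b = eqm a (-1 - b).
Proof. by apply/eqmP/eqmP => -[q h]; exists (- q); lia. Qed.

Lemma eqm_self_star a : eqm a (-1 - a) = false.
Proof. apply/eqmP => -[q h]; lia. Qed.

Lemma eqm_near a b : a < b -> b < a + n -> eqm a b = false.
Proof.
move=> h1 h2; apply/eqmP => -[q h].
have : q < 0 \/ 0 <= q by lia.
case=> hq; last nia.
have : q * n <= (- 1) * n by nia. lia.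
Qed.

Lemma res_subproof t : (absz (t %% n)%Z < m.*2)%N.
Proof. have := ltz_pmod t n_gt0; have := modz_ge0 t n_neq0; lia. Qed.
Definition res t : I2 := Ordinal (res_subproof t).

Lemma val_res t : Posz (nat_of_ord (res t)) = (t %% n)%Z.
Proof. by rewrite /= gez0_abs // modz_ge0 ?n_neq0. Qed.

Lemma resE t : Posz (nat_of_ord (res t)) = t - fl 0 t * n.
Proof. rewrite val_res /fl subr0; have := divz_eq t n; lia. Qed.

Lemma fl_ord0 (j : I2) : fl 0 (Posz (nat_of_ord j)) = 0.
Proof. have hj := ltn_ord j; apply: fl_uniq; lia. Qed.

Lemma res_eq (t : int) (j : I2) : eqm t (Posz (nat_of_ord j)) -> res t = j.
Proof.
move=> /eqmP[q h]; apply: ord_inj; apply/eqP; rewrite -eqz_nat resE.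
by rewrite h fl_per fl_ord0; apply/eqP; lia.
Qed.

Lemma res_ord (j : I2) : res (Posz (nat_of_ord j)) = j.
Proof. by apply: res_eq; apply: eqmxx. Qed.

Lemma eqm_res t : eqm (Posz (nat_of_ord (res t))) t.
Proof. by apply/eqmP; exists (- fl 0 t); rewrite resE; lia. Qed.

Lemma res_eqm a b : (res a == res b) = eqm a b.
Proof.
apply/eqP/idP => [h|h].
  by rewrite eqmC; apply: eqm_trans (eqm_res a); rewrite h eqmC eqm_res.
by apply: res_eq; apply: eqm_trans h _; rewrite eqmC eqm_res.
Qed.

Lemma ordE (j : I2) t : eqm (Posz (nat_of_ord j)) t = (j == res t).
Proof. by rewrite -{2}(res_ord j) res_eqm. Qed.

Lemma star_val (j : I2) : Posz (nat_of_ord (star j)) = n - 1 - Posz (nat_of_ord j).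
Proof. have := ltn_ord j; rewrite /star /=; lia. Qed.

Lemma res_star t : res (-1 - t) = star (res t).
Proof.
apply: res_eq; rewrite star_val; apply/eqmP; exists (- fl 0 t - 1).
by rewrite resE; lia.
Qed.

Lemma ord_decomp t : t = Posz (nat_of_ord (res t)) + fl 0 t * n.
Proof. by rewrite resE; lia. Qed.

Lemma omegaE i (j : I2) : omega i j = fl i (Posz (nat_of_ord j)).
Proof.
rewrite /omega; have hj := ltn_ord j.
rewrite /=; have hi := divz_eq i n; have := ltz_pmod i n_gt0; have := modz_ge0 i n_neq0.
move: (i %/ n)%Z (i %% n)%Z hi => d r -> h1 h2.
by symmetry; case: ltP => h; apply: fl_uniq; lia.
Qed.

(** * Affine transformations as periodic bijections of the integers *)

Fact U_key : unit. Proof. exact: tt. Qed.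
(* [U w] is the bijection of [int] commuting with [+ n] such that [w] sends [omega i] to
   [fun j => fl i (U w j)], where [omega i j = fl i j]; note that [U] is contravariant in [w].
   The coordinate [star j] corresponds to [-1 - j] modulo [n]. *)
Definition U w t : int := locked_with U_key
  (Posz (nat_of_ord ((w.2)^-1%g (res t))) + (w.1 (res t) + fl 0 t) * n).

Lemma UE w t :
  U w t = Posz (nat_of_ord ((w.2)^-1%g (res t))) + (w.1 (res t) + fl 0 t) * n.
Proof. by rewrite /U unlock. Qed.

Lemma U_ord w (j : I2) : U w (Posz (nat_of_ord j)) = Posz (nat_of_ord ((w.2)^-1%g j)) + w.1 j * n.
Proof.
rewrite !UE res_ord; have hj := ltn_ord j.
have -> : fl 0 (Posz (nat_of_ord j)) = 0 by apply: fl_uniq; lia.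
by rewrite addr0.
Qed.

Lemma U_per w t q : U w (t + q * n) = U w t + q * n.
Proof.
rewrite !UE fl_per; have -> : res (t + q * n) = res t.
  by apply/eqP; rewrite res_eqm eqm_shift.
lia.
Qed.

Lemma res_U w t : res (U w t) = (w.2)^-1%g (res t).
Proof. by apply: res_eq; rewrite UE; apply: eqm_shift. Qed.

Lemma U_eqm w a b : eqm (U w a) (U w b) = eqm a b.
Proof. by rewrite -!res_eqm !res_U (inj_eq perm_inj). Qed.

Lemma U_inj w : injective (U w).
Proof.
move=> a b h.
have : eqm a b by rewrite -(U_eqm w) h eqmxx.
by move=> /eqmP[q e]; move: h; rewrite e U_per; lia.
Qed.

Lemma U_surj w t : exists a, U w a = t.
Proof.
pose j := w.2 (res t).
exists (Posz (nat_of_ord j) + (fl 0 t - w.1 j) * n).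
rewrite U_per U_ord /j permK [RHS](ord_decomp t); lia.
Qed.

Lemma U_ext w w' : (forall t, U w t = U w' t) -> w = w'.
Proof.
move=> h; have h1 (j : I2) : (w.2)^-1%g j = (w'.2)^-1%g j /\ w.1 j = w'.1 j.
  have := h (Posz (nat_of_ord j)); rewrite !U_ord.
  set x := (w.2)^-1%g j; set y := (w'.2)^-1%g j => e.
  have e1 : x = y.
    rewrite -(res_ord x) -(res_ord y); apply/eqP; rewrite res_eqm.
    by apply/eqmP; exists (w'.1 j - w.1 j); lia.
  by split=> //; move: e; rewrite e1; nia.
case: w w' h h1 => [l s] [l' s'] /= _ h1; congr pair.
  by apply/ffunP => j; case: (h1 j).
by apply: invg_inj; apply/permP => j; case: (h1 j).
Qed.

Lemma U_mul w w' t : U (ewmul w w') t = U w' (U w t).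
Proof.
have fU : fl 0 (U w t) = w.1 (res t) + fl 0 t.
  by rewrite !UE fl_per fl_ord0 add0r.
rewrite [RHS]UE res_U fU UE /= !ffunE invMg permM /=. ring.
Qed.

Lemma U_1 t : U (ew1 m) t = t.
Proof. by rewrite !UE /= invg1 perm1 ffunE add0r -ord_decomp. Qed.

Definition ewinv w : ew m := ([ffun i => - w.1 (w.2 i)], (w.2)^-1%g).

Lemma U_invK w t : U w (U (ewinv w) t) = t.
Proof.
rewrite -U_mul [LHS]UE /= ffunE !invgK mulgV invg1 perm1 ffunE.
by rewrite [RHS]ord_decomp; lia.
Qed.

Lemma U_Kinv w t : U (ewinv w) (U w t) = t.
Proof. by apply: (@U_inj w); rewrite U_invK. Qed.

(** Periodicity and injectivity make the induced map on the finite set of residues a permutation;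
    the floors of the values [u j] give the translation part. *)
Lemma exists_ew (u : int -> int) :
  (forall t q, u (t + q * n) = u t + q * n) -> injective u ->
  exists w, forall t, U w t = u t.
Proof.
move=> uper uinj.
pose f (j : I2) := res (u (Posz (nat_of_ord j))).
have finj : injective f.
  move=> j k /eqP; rewrite res_eqm => /eqmP[q e].
  rewrite -(res_ord j) -(res_ord k); apply/eqP; rewrite res_eqm.
  by apply/eqmP; exists q; apply: uinj; rewrite uper.
exists ([ffun j : I2 => fl 0 (u (Posz (nat_of_ord j)))], (perm finj)^-1%g) => t.
rewrite !UE /= invgK permE ffunE /f [in RHS](ord_decomp t) uper.
rewrite [in RHS](ord_decomp (u _)); lia.
Qed.

Lemma actE w i (j : I2) : Defs.act w (omega i) j = fl i (U w (Posz (nat_of_ord j))).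
Proof. by rewrite /Defs.act omegaE U_ord fl_per; lia. Qed.

(** Modulo [n] the equation is the condition on the permutation; comparing quotients gives the
    condition on the translation part, and [c] is the common value of [w.1 j + w.1 (star j)]. *)
Lemma inWP w : inW w <-> exists c : int, forall t, U w t + U w (-1 - t) = -1 + c * n.
Proof.
split.
  move=> [h1 h2].
  pose o := res 0; exists (w.1 o + w.1 (star o)) => t.
  have hs : (w.2)^-1%g (star (res t)) = star ((w.2)^-1%g (res t)).
    by apply: (@perm_inj _ w.2); rewrite permKV h2 permKV.
  rewrite !UE res_star hs star_val; have := h1 (res t) o.
  have -> : fl 0 (-1 - t) = -1 - fl 0 t by rewrite -{1}oppr0 fl_star.
  set x := w.1 _; set y := w.1 _ => e.
  have -> : w.1 o + w.1 (star o) = x + y by [].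
  lia.
move=> [c h].
have key (j : I2) : (w.2)^-1%g (star j) = star ((w.2)^-1%g j) /\ w.1 j + w.1 (star j) = c.
  have := h (Posz (nat_of_ord j) + (-1) * n + 1 * n).
  have -> : -1 - (Posz (nat_of_ord j) + (-1) * n + 1 * n) = Posz (nat_of_ord (star j)) + (-1) * n.
    by rewrite star_val; lia.
  rewrite !U_per !U_ord => e.
  have e1 : (w.2)^-1%g (star j) = star ((w.2)^-1%g j).
    set x := _ (star j) in e *; set y := _ j in e *.
    rewrite -(res_ord x) -(res_ord (star y)); apply/eqP; rewrite res_eqm star_val.
    by apply/eqmP; exists (c - w.1 j - w.1 (star j)); lia.
  split=> //; move: e; rewrite e1 star_val; nia.
split; first by move=> j k; rewrite (key j).2 (key k).2.
by move=> j; apply: (@perm_inj _ (w.2)^-1%g); rewrite permK (key (w.2 j)).1 permK.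
Qed.

Lemma inW_mul w w' : inW w -> inW w' -> inW (ewmul w w').
Proof.
move=> /inWP[c h] /inWP[c' h']; apply/inWP; exists (c + c') => t.
rewrite !U_mul; have -> : U w (-1 - t) = -1 - U w t + c * n by have := h t; lia.
by rewrite U_per; have := h' (U w t); lia.
Qed.

Lemma inW_inv w : inW w -> inW (ewinv w).
Proof.
move=> /inWP[c h]; apply/inWP; exists (- c) => t.
have -> : U (ewinv w) (-1 - t) = -1 - U (ewinv w) t + (- c) * n; last by lia.
apply: (@U_inj w); rewrite U_invK U_per.
by have := h (U (ewinv w) t); rewrite U_invK; lia.
Qed.

Lemma inW1 : inW (ew1 m).
Proof. by apply/inWP; exists 0 => t; rewrite !U_1; lia. Qed.

Lemma ewmulA w1 w2 w3 : ewmul w1 (ewmul w2 w3) = ewmul (ewmul w1 w2) w3.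
Proof. by apply: U_ext => t; rewrite !U_mul. Qed.
Lemma ewmul1 w : ewmul w (ew1 m) = w.
Proof. by apply: U_ext => t; rewrite !U_mul U_1. Qed.
Lemma ew1mul w : ewmul (ew1 m) w = w.
Proof. by apply: U_ext => t; rewrite !U_mul U_1. Qed.
Lemma ewmulV w : ewmul w (ewinv w) = ew1 m.
Proof. by apply: U_ext => t; rewrite !U_mul U_1 U_Kinv. Qed.
Lemma ewVmul w : ewmul (ewinv w) w = ew1 m.
Proof. by apply: U_ext => t; rewrite !U_mul U_1 U_invK. Qed.

(** * Affine reflections *)

(* The hyperplanes [x_i - x_j = k] become the equalities [x a = x b], for integers [a], [b] that are
   distinct modulo [n], once [x] is extended to [int] by [x (t + n) = x t + 1]; in these terms the
   reflection exchanges [a] and [b], and simultaneously [-1 - a] and [-1 - b]. *)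
Definition R a b t : int :=
  if eqm t a then t + (b - a) else if eqm t b then t - (b - a)
  else if eqm t (-1 - a) then t - (b - a)
  else if eqm t (-1 - b) then t + (b - a) else t.

Variant R_spec a b : int -> int -> Prop :=
  | R_spec_l q : R_spec a b (a + q * n) (b + q * n)
  | R_spec_r q : R_spec a b (b + q * n) (a + q * n)
  | R_spec_sl q : R_spec a b (-1 - a + q * n) (-1 - b + q * n)
  | R_spec_sr q : R_spec a b (-1 - b + q * n) (-1 - a + q * n)
  | R_spec_out t of ~~ eqm t a & ~~ eqm t b & ~~ eqm t (-1 - a) & ~~ eqm t (-1 - b) :
      R_spec a b t t.

Lemma RP a b t : R_spec a b t (R a b t).
Proof.
rewrite /R; case: ifP => [/eqmP[q ->]|/negbT h1].
  have -> : a + q * n + (b - a) = b + q * n; [lia|constructor].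
case: ifP => [/eqmP[q ->]|/negbT h2].
  have -> : b + q * n - (b - a) = a + q * n; [lia|constructor].
case: ifP => [/eqmP[q ->]|/negbT h3].
  have -> : -1 - a + q * n - (b - a) = -1 - b + q * n; [lia|constructor].
case: ifP => [/eqmP[q ->]|/negbT h4].
  have -> : -1 - b + q * n + (b - a) = -1 - a + q * n; [lia|constructor].
by constructor.
Qed.

Lemma R_l a b q : R a b (a + q * n) = b + q * n.
Proof. by rewrite /R eqm_shift; lia. Qed.

Lemma R_r a b q : ~~ eqm a b -> R a b (b + q * n) = a + q * n.
Proof. by move=> h; rewrite /R eqm_shift (eqm_l _ (eqm_shift b q)) eqmC (negbTE h); lia. Qed.

Lemma R_sl a b q : R a b (-1 - a + q * n) = -1 - b + q * n.
Proof.
rewrite /R eqm_shift !(eqm_l _ (eqm_shift _ q)).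
rewrite eqmC eqm_self_star.
by case: ifP => _; lia.
Qed.

Lemma R_sr a b q : ~~ eqm a b -> R a b (-1 - b + q * n) = -1 - a + q * n.
Proof.
move=> h; rewrite /R eqm_shift !(eqm_l _ (eqm_shift _ q)) [eqm (-1 - b) b]eqmC eqm_self_star.
by rewrite eqm_star [eqm b a]eqmC (negbTE h); case: ifP => _; lia.
Qed.

Lemma R_out a b t :
  ~~ eqm t a -> ~~ eqm t b -> ~~ eqm t (-1 - a) -> ~~ eqm t (-1 - b) -> R a b t = t.
Proof. by rewrite /R => /negbTE-> /negbTE-> /negbTE-> /negbTE->. Qed.

Lemma R_l0 a b : R a b a = b.
Proof. by have := R_l a b 0; rewrite mul0r !addr0. Qed.

Lemma R_r0 a b : ~~ eqm a b -> R a b b = a.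
Proof. by move=> /(R_r 0); rewrite mul0r !addr0. Qed.

Lemma R_per a b t q : R a b (t + q * n) = R a b t + q * n.
Proof.
rewrite /R !(eqm_l _ (eqm_shift t q)).
by do ! case: ifP => _; lia.
Qed.

Lemma RK a b t : ~~ eqm a b -> R a b (R a b t) = t.
Proof.
move=> h; case: (RP a b t) => *; by rewrite ?R_l ?R_r ?R_sl ?R_sr ?R_out.
Qed.

Lemma R_inj a b : ~~ eqm a b -> injective (R a b).
Proof. by move=> h; apply: can_inj (fun t => RK t h). Qed.

Lemma R_starr a b t : ~~ eqm a b -> R a b (-1 - t) = -1 - R a b t.
Proof.
move=> h; case: (RP a b t) => [q|q|q|q|u h1 h2 h3 h4].
- by rewrite (_ : -1 - (a + q * n) = -1 - a + (- q) * n) ?R_sl; lia.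
- by rewrite (_ : -1 - (b + q * n) = -1 - b + (- q) * n) ?R_sr //; lia.
- by rewrite (_ : -1 - (-1 - a + q * n) = a + (- q) * n) ?R_l; lia.
- by rewrite (_ : -1 - (-1 - b + q * n) = b + (- q) * n) ?R_r //; lia.
by rewrite R_out // ?eqm_star // eqm_starl.
Qed.

Lemma R_sym a b t : ~~ eqm a b -> R a b t = R b a t.
Proof.
move=> h; have h' : ~~ eqm b a by rewrite eqmC.
by case: (RP a b t) => *; rewrite ?R_l ?R_r ?R_sl ?R_sr ?R_out.
Qed.

Lemma R_shift a b q t : ~~ eqm a b -> R (a + q * n) (b + q * n) t = R a b t.
Proof.
move=> h.
have h' : ~~ eqm (a + q * n) (b + q * n).
  by rewrite (eqm_l _ (eqm_shift a q)) eqmC (eqm_l _ (eqm_shift b q)) eqmC.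
case: (RP a b t) => [q'|q'|q'|q'|u h1 h2 h3 h4].
- have -> : a + q' * n = a + q * n + (q' - q) * n by lia.
  by rewrite R_l; lia.
- have -> : b + q' * n = b + q * n + (q' - q) * n by lia.
  by rewrite R_r //; lia.
- have -> : -1 - a + q' * n = -1 - (a + q * n) + (q' + q) * n by lia.
  by rewrite R_sl; lia.
- have -> : -1 - b + q' * n = -1 - (b + q * n) + (q' + q) * n by lia.
  by rewrite R_sr //; lia.
have e (x y q' : int) : eqm x (y + q' * n) = eqm x y.
  by rewrite eqmC (eqm_l _ (eqm_shift y q')) eqmC.
have e' (x y : int) : eqm x (-1 - (y + q * n)) = eqm x (-1 - y).
  have -> : -1 - (y + q * n) = -1 - y + (- q) * n by lia.
  exact: e.
by rewrite R_out ?e ?e'.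
Qed.

Lemma R_dual a b t : ~~ eqm a b -> R (-1 - a) (-1 - b) t = R a b t.
Proof.
move=> h.
have h' : ~~ eqm (-1 - a) (-1 - b) by rewrite eqm_star.
have e (x : int) : -1 - (-1 - x) = x by lia.
case: (RP a b t) => [q|q|q|q|u h1 h2 h3 h4].
- by have := R_sl (-1 - a) (-1 - b) q; rewrite !e.
- by have := R_sr q h'; rewrite !e.
- by rewrite R_l.
- by rewrite R_r.
by rewrite R_out ?e.
Qed.

(** [U w] carries mirror images to mirror images up to the constant shift [c * n], to which periodic
    exchanges are insensitive. *)
Lemma R_conj w a b t : inW w -> ~~ eqm a b ->
  U w (R a b t) = R (U w a) (U w b) (U w t).
Proof.
move=> /inWP[c hc] h; have h' : ~~ eqm (U w a) (U w b) by rewrite U_eqm.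
have e (x : int) : U w (-1 - x) = -1 - U w x + c * n by have := hc x; lia.
have e2 (x q : int) : U w (-1 - x + q * n) = -1 - U w x + (c + q) * n by rewrite U_per e; lia.
case: (RP a b t) => [q|q|q|q|u h1 h2 h3 h4].
- by rewrite !U_per R_l.
- by rewrite !U_per R_r.
- by rewrite !e2 R_sl.
- by rewrite !e2 R_sr.
have e3 (x : int) : eqm (U w u) (-1 - U w x) = eqm u (-1 - x).
  by rewrite -[RHS](U_eqm w) e [RHS]eqmC [RHS](eqm_l _ (eqm_shift _ c)) eqmC.
by rewrite R_out ?U_eqm ?e3.
Qed.

Lemma exists_R a b : ~~ eqm a b -> exists w, inW w /\ forall t, U w t = R a b t.
Proof.
move=> h; have [w hw] := exists_ew (R_per a b) (R_inj h).
by exists w; split=> //; apply/inWP; exists 0 => t; rewrite !hw R_starr //; lia.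
Qed.

(** * The base alcove and its stabilizer *)

Definition ext (x : I2 -> rat) t : rat := x (res t) + (fl 0 t)%:~R.

Lemma ext_ord (x : I2 -> rat) (j : I2) : ext x (Posz (nat_of_ord j)) = x j.
Proof. by rewrite /ext res_ord fl_ord0 addr0. Qed.

Lemma ext_per (x : I2 -> rat) t q : ext x (t + q * n) = ext x t + q%:~R.
Proof.
rewrite /ext fl_per intrD addrA; congr (x _ + _ + _).
by apply/eqP; rewrite res_eqm eqm_shift.
Qed.

Lemma ext_act w (x : I2 -> rat) t : ext (Defs.act w x) t = ext x (U w t).
Proof.
rewrite /ext /Defs.act res_U UE fl_per fl_ord0 add0r intrD.
by rewrite addrAC addrC addrA.
Qed.

Lemma inVP (x : I2 -> rat) : inV x <-> exists C : rat, forall t, ext x t + ext x (-1 - t) = C.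
Proof.
split.
  move=> h; exists (x (res 0) + x (star (res 0)) - 1) => t.
  have h1 := h (res t) (res 0).
  have h2 : fl 0 (-1 - t) = -1 - fl 0 t by rewrite -{1}oppr0 fl_star.
  rewrite -h1 /ext res_star h2 intrD rmorphN /=; lra.
move=> [C h]; have key j : x j + x (star j) = C + 1.
  rewrite -(h (Posz (nat_of_ord j))) ext_ord.
  have -> : -1 - Posz (nat_of_ord j) = Posz (nat_of_ord (star j)) + (-1) * n.
    by rewrite star_val; lia.
  rewrite ext_per ext_ord rmorphN /=; lra.
by move=> j k; rewrite !key.
Qed.

Lemma increasingP d (T : porderType d) (f : int -> T) :
  (forall t, (f t < f (t + 1))%O) -> forall a b, a < b -> (f a < f b)%O.
Proof.
move=> h a b hab.
have -> : b = a + Posz (absz (b - a)) by lia.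
have : (0 < absz (b - a))%N by lia.
elim: (absz (b - a)) => // k IH _.
have -> : a + Posz k.+1 = a + Posz k + 1 by lia.
case: k IH => [|k] IH; first by rewrite addr0.
exact: lt_trans (IH isT) (h _).
Qed.

(** The inequalities defining the alcove cover the lower half of a period and its end; membership in
    [V] reflects the lower half onto the upper one. *)
Lemma inAP (x : I2 -> rat) : inA x <-> inV x /\ forall t, ext x t < ext x (t + 1).
Proof.
split; last first.
  move=> [hV h]; split=> //; split.
    move=> f l hf hl; have := h (Posz (nat_of_ord l)); rewrite ext_ord.
    have -> : Posz (nat_of_ord l) + 1 = Posz (nat_of_ord f) + 1 * n.
      by rewrite /= in hf hl *; lia.
    rewrite ext_per ext_ord /=; lra.
  move=> j j' hj hj'; have := h (Posz (nat_of_ord j)).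
  have -> : Posz (nat_of_ord j) + 1 = Posz (nat_of_ord j') by rewrite /= in hj hj' *; lia.
  by rewrite !ext_ord.
move=> [hV [h1 h2]]; split=> // t.
have [C hC] := (inVP x).1 hV.
have low (j : int) q : 0 <= j -> j < m%:Z -> ext x (j + q * n) < ext x (j + q * n + 1).
  move=> hj0 hj.
  have -> : j + q * n + 1 = (j + 1) + q * n by lia.
  rewrite !ext_per ltrD2r.
  have hj1 : (absz j < m.*2)%N by lia.
  have hj2 : (absz (j + 1)%R < m.*2)%N by lia.
  have -> : j = Posz (nat_of_ord (Ordinal hj1)) by rewrite /=; lia.
  have -> : Posz (nat_of_ord (Ordinal hj1)) + 1 = Posz (nat_of_ord (Ordinal hj2)).
    by rewrite /=; lia.
  by rewrite !ext_ord; apply: h2; rewrite /=; lia.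
have hb := fl_bounds 0 t; set q := fl 0 t in hb.
case: (ltP t (q * n + m%:Z)) => ht.
  by rewrite (_ : t = t - q * n + q * n); [apply: low; lia | lia].
case: (eqVneq t (q * n + n - 1)) => [->|ht'].
  have l1 : (m.*2.-1 < m.*2)%N by lia.
  have l0 : (0 < m.*2)%N by lia.
  have -> : q * n + n - 1 = Posz (nat_of_ord (Ordinal l1)) + q * n by rewrite /=; lia.
  have -> : Posz (nat_of_ord (Ordinal l1)) + q * n + 1 =
            Posz (nat_of_ord (Ordinal l0)) + (q + 1) * n by rewrite /=; lia.
  rewrite !ext_per !ext_ord intrD.
  by have := h1 (Ordinal l0) (Ordinal l1) erefl erefl; lra.
(* In the upper half, the mirror image of the pair [t], [t + 1] falls into the range of [low]. *)
have := hC t; have := hC (t + 1).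
have := low (q * n + n - 2 - t) (- q - 1).
have -> : q * n + n - 2 - t + (- q - 1) * n = -1 - (t + 1) by lia.
have -> : -1 - (t + 1) + 1 = -1 - t by lia.
move=> h3; have {}h3 := h3 ltac:(lia) ltac:(lia); lra.
Qed.

Lemma U_shift w : (forall t, U w t < U w (t + 1)) -> exists r, forall t, U w t = t + r.
Proof.
move=> h; have mono := increasingP h.
have step t : U w (t + 1) = U w t + 1.
  have [a ha] := U_surj w (U w t + 1).
  case: (ltgtP a (t + 1)) => hat; last by rewrite -hat.
    have : a <= t by lia.
    by rewrite le_eqVlt => /orP[/eqP e|/mono]; [move: ha; rewrite e; lia | lia].
  by have := mono _ _ hat; have := h t; lia.
have stepn (k : nat) t : U w (t + Posz k) = U w t + Posz k.
  elim: k => [|k IH]; first by rewrite !addr0.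
  have -> : t + Posz k.+1 = t + Posz k + 1 by lia.
  rewrite step IH; lia.
exists (U w 0) => t.
case: (leP 0 t) => ht.
  by have := stepn (absz t) 0; rewrite add0r gez0_abs //; lia.
have := stepn (absz t) t; rewrite (_ : t + Posz (absz t) = 0); lia.
Qed.

Lemma inOmegaP w : inOmega w <-> inW w /\ forall t, U w t < U w (t + 1).
Proof.
have n0 : 0 < n%:~R :> rat by rewrite ltr0z n_gt0.
split.
  move=> [hW h]; split=> // t.
  (* A point of the alcove with [ext x a = a / n]: its image under [w] lies in the alcove only if
     [U w] is increasing. *)
  pose x (j : I2) : rat := (Posz (nat_of_ord j))%:~R / n%:~R.
  have hx a : ext x a = a%:~R / n%:~R.
    rewrite [in RHS](ord_decomp a) intrD intrM /ext /x mulrDl mulfK //.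
    by rewrite gt_eqF.
  have : inA x.
    apply/inAP; split.
      apply/inVP; exists (- 1 / n%:~R) => a; rewrite !hx -mulrDl -intrD.
      by congr (_ / _); rewrite (_ : a + (-1 - a) = -1) //; lia.
    by move=> a; rewrite !hx ltr_pM2r ?invr_gt0 // ltr_int; lia.
  move=> /(h x).1 /inAP[_ /(_ t)]; rewrite !ext_act !hx.
  by rewrite ltr_pM2r ?invr_gt0 // ltr_int.
move=> [hW h]; split=> // x; have [r hr] := U_shift h.
have [c hc] := (inWP w).1 hW.
have e2 : 2 * r = c * n by have := hc 0; rewrite !hr; lia.
split=> /inAP[/inVP[C hC] hi]; apply/inAP; split.
- apply/inVP; exists (C + c%:~R) => t; rewrite !ext_act !hr.
  have -> : -1 - t + r = -1 - (t + r) + c * n by lia.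
  by rewrite ext_per addrA hC.
- by move=> t; rewrite !ext_act !hr (_ : t + 1 + r = t + r + 1); [exact: hi | lia].
- apply/inVP; exists (C - c%:~R) => t.
  have := hC (t - r); rewrite !ext_act !hr.
  have -> : t - r + r = t by lia.
  have -> : -1 - (t - r) + r = -1 - t + c * n by lia.
  rewrite ext_per; lra.
move=> t; have := hi (t - r); rewrite !ext_act !hr.
have -> : t - r + r = t by lia.
by have -> : t - r + 1 + r = t + 1 by lia.
Qed.

Lemma inOmega_inv w : inOmega w -> inOmega (ewinv w).
Proof.
move=> /inOmegaP[h1 h2]; apply/inOmegaP; split; first exact: inW_inv.
move=> t; have mono := increasingP h2.
case: ltP => //; rewrite le_eqVlt => /orP[/eqP /U_inj|/mono]; first lia.
rewrite !U_invK; lia.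
Qed.

(** * Reflections of the apartment *)

Lemma starK (l : I2) : star (star l) = l.
Proof. exact: rev_ordK. Qed.

Lemma star_eq (l l' : I2) : (star l == l') = (l == star l').
Proof. by rewrite -{1}[l']starK (inj_eq (inv_inj starK)). Qed.

Lemma star_neq (l : I2) : (l == star l) = false.
Proof.
apply/eqP => e; have := star_val l; rewrite -e; lia.
Qed.

Lemma eqm_ord (l l' : I2) : eqm (Posz (nat_of_ord l)) (Posz (nat_of_ord l')) = (l == l').
Proof. by rewrite ordE res_ord. Qed.

Lemma eqm_shiftr a b q : eqm a (b + q * n) = eqm a b.
Proof. by rewrite eqmC (eqm_l _ (eqm_shift b q)) eqmC. Qed.

Lemma eqm_ord_star (l l' : I2) :
  eqm (Posz (nat_of_ord l)) (-1 - Posz (nat_of_ord l')) = (l == star l').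
Proof.
rewrite -eqm_ord star_val -[in LHS](eqm_shiftr _ _ 1); congr eqm; lia.
Qed.

Lemma reflH_R (i j : I2) (k : int) w : i != j ->
  (forall t, U w t = R (Posz (nat_of_ord i)) (Posz (nat_of_ord j) + k * n) t) ->
  reflH i j k w.
Proof.
move=> hij hw; set a := Posz (nat_of_ord i) in hw; set b := _ + _ in hw.
have hab : ~~ eqm a b by rewrite eqm_shiftr eqm_ord.
split; first by apply/inWP; exists 0 => t; rewrite !hw R_starr //; lia.
split.
  move=> e; have := hw a; rewrite e U_1 R_l0 => e2.
  by move: hab; rewrite -e2 eqmxx.
move=> x /inVP[C hC] hx l; rewrite -!ext_ord ext_act hw.
have e : ext x b = ext x a by rewrite /b ext_per !ext_ord -hx; lra.
have e' : ext x (-1 - b) = ext x (-1 - a) by have := hC a; have := hC b; rewrite e; lra.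
by clearbody b; case: (RP a b l) => *; rewrite ?ext_per ?e ?e'.
Qed.

(* Linear parts are tested on [e_l - e_l*], and translation parts on one point of the hyperplane. *)
Lemma R_reflH (i j : I2) (k : int) w : i != j -> reflH i j k w ->
  forall t, U w t = R (Posz (nat_of_ord i)) (Posz (nat_of_ord j) + k * n) t.
Proof.
move=> hij [hW [hne hfix]].
pose p l := (w.2)^-1%g l.
have pinj : injective p by apply: perm_inj.
have pstar (l : I2) : p (star l) = star (p l).
  by apply: (@perm_inj _ w.2); rewrite /p permKV hW.2 permKV.
have fixx (x : I2 -> rat) l : inV x -> x i - x j = k%:~R -> (w.1 l)%:~R + x (p l) = x l.
  by move=> h1 h2; apply: (hfix x h1 h2).
(* The point [x0] is supported on [i] and [star i]. If [j = star i], both of its nonzero entries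
   contribute to [x0 i - x0 j], hence the factor one half. *)
pose kap : rat := if j == star i then k%:~R / 2 else k%:~R.
pose x0 (l : I2) : rat := kap * ((l == i)%:R - (l == star i)%:R).
have x0s l : x0 (star l) = - x0 l.
  by rewrite /x0 !star_eq starK; lra.
have x0V : inV x0 by move=> l l'; rewrite !x0s; lra.
have x0H : x0 i - x0 j = k%:~R.
  rewrite /x0 /kap eqxx star_neq [j == i]eq_sym (negbTE hij).
  by case: (j == star i); rewrite /=; lra.
(* Such a [d] is a direction of the hyperplane; subtracting the fixed points [x0 + d] and [x0] shows
   that the linear part fixes [d]. *)
have dir (d : I2 -> rat) l : (forall l, d (star l) = - d l) -> d i = d j -> d (p l) = d l.
  move=> hs hd; have h1 := fixx _ l x0V x0H.
  have := fixx (fun l => x0 l + d l) l _ _; rewrite hd => h2.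
  have {}h2 : (w.1 l)%:~R + (x0 (p l) + d (p l)) = x0 l + d l.
    apply: h2; last by move: x0H; lra.
    by move=> l1 l2; rewrite !hs !x0s; lra.
  by move: h1 h2; lra.
have sgn_star (l0 l : I2) : ((star l == l0)%:R - (star l == star l0)%:R : rat) =
    - ((l == l0)%:R - (l == star l0)%:R).
  by rewrite !star_eq starK; lra.
have pout (l : I2) : l != i -> l != j -> l != star i -> l != star j -> p l = l.
  move=> h1 h2 h3 h4.
  have hi : (i == l) = false by rewrite eq_sym (negbTE h1).
  have hj : (j == l) = false by rewrite eq_sym (negbTE h2).
  have hsi : (i == star l) = false by rewrite -star_eq eq_sym (negbTE h3).
  have hsj : (j == star l) = false by rewrite -star_eq eq_sym (negbTE h4).
  pose d (l' : I2) : rat := (l' == l)%:R - (l' == star l)%:R.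
  have := dir d l (sgn_star l); rewrite /d.
  rewrite hi hj hsi hsj eqxx star_neq => /(_ erefl).
  by case: (eqVneq (p l) l) => // _; case: (_ == _) => /= /eqP.
have pij (l : I2) : l = i \/ l = j -> p l = i \/ p l = j.
  move=> hl; case: (eqVneq j (star i)) => [e|ne].
    case: (eqVneq (p l) i) => [|h1]; first by left.
    case: (eqVneq (p l) j) => [|h2]; first by right.
    have e2 : star j = i by rewrite e starK.
    have h3 : p (p l) = p l by apply: pout; rewrite ?e2 -?e.
    by have := pinj _ _ h3 => e3; rewrite e3.
  pose d (l' : I2) : rat := ((l' == i)%:R - (l' == star i)%:R) + ((l' == j)%:R - (l' == star j)%:R).
  have ne' : (i == star j) = false by rewrite -star_eq eq_sym (negbTE ne).
  have ds (l' : I2) : d (star l') = - d l' by rewrite /d !sgn_star [RHS]opprD.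
  have dij : d i = d j.
    by rewrite /d !eqxx !star_neq [j == i]eq_sym (negbTE hij) (negbTE ne) ne' /=; lra.
  have hd := dir d l ds dij; rewrite /d in hd.
  have {}hd : ((p l == i)%:R - (p l == star i)%:R) +
              ((p l == j)%:R - (p l == star j)%:R) = 1 :> rat.
    rewrite hd; case: hl => ->.
      by rewrite eqxx star_neq (negbTE hij) ne' /=; lra.
    by rewrite eqxx star_neq [j == i]eq_sym (negbTE hij) (negbTE ne) /=; lra.
  case: (eqVneq (p l) i) hd => [|h1']; first by left.
  case: (eqVneq (p l) j) => [|h2']; first by right.
  by do ! case: (_ == _) => /=; move=> /eqP.
have lamE l : (w.1 l)%:~R = x0 l - x0 (p l) by rewrite -(fixx _ l x0V x0H); lra.
have lam_fix l : p l = l -> w.1 l = 0.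
  by move=> h; apply/eqP; rewrite -(intr_eq0 rat) lamE h subrr.
have per_eq (f g : int -> int) :
    (forall t q, f (t + q * n) = f t + q * n) -> (forall t q, g (t + q * n) = g t + q * n) ->
    (forall l : I2, f (Posz (nat_of_ord l)) = g (Posz (nat_of_ord l))) -> forall t, f t = g t.
  by move=> hf hg h t; rewrite (ord_decomp t) hf hg h.
(* If [p] fixes [i] it fixes every index, and then the translation part vanishes as well, so that
   [w] would be the identity. *)
case: (pij i (or_introl erefl)) => [pii|pi].
  have pjj : p j = j.
    by case: (pij j (or_intror erefl)) => // e; move: hij; rewrite (pinj i j) ?eqxx // pii e.
  case: hne; apply: U_ext; apply: per_eq (U_per w) (U_per (ew1 m)) _ => l.
  have pl : p l = l.
    case: (eqVneq l i) => [->//|h1]; case: (eqVneq l j) => [->//|h2].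
    case: (eqVneq l (star i)) => [->|h3]; first by rewrite pstar pii.
    case: (eqVneq l (star j)) => [->|h4]; first by rewrite pstar pjj.
    exact: pout.
  by rewrite U_1 U_ord -/(p l) lam_fix // pl; lia.
clear hne.
have pj : p j = i.
  by case: (pij j (or_intror erefl)) => // e; move: hij; rewrite (pinj i j) ?eqxx // pi e.
have li : w.1 i = k by apply/eqP; rewrite -(eqr_int rat) lamE pi x0H.
have lj : w.1 j = - k by apply/eqP; rewrite -(eqr_int rat) lamE pj rmorphN /= -x0H; lra.
have lsi : w.1 (star i) = - k.
  by apply/eqP; rewrite -(eqr_int rat) lamE pstar pi !x0s rmorphN /= -x0H; lra.
have lsj : w.1 (star j) = k.
  by apply/eqP; rewrite -(eqr_int rat) lamE pstar pj !x0s -x0H; lra.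
set a := Posz (nat_of_ord i); set b := _ + _.
have hab : ~~ eqm a b by rewrite eqm_shiftr eqm_ord.
apply: per_eq (U_per w) (R_per a b) _ => l; rewrite U_ord -/(p l).
case: (eqVneq l i) => [->|h1]; first by rewrite pi li R_l0.
case: (eqVneq l j) => [->|h2].
  have -> : Posz (nat_of_ord j) = b + (- k) * n by rewrite /b; lia.
  by rewrite R_r // pj lj.
case: (eqVneq l (star i)) => [->|h3].
  have -> : Posz (nat_of_ord (star i)) = -1 - a + 1 * n by rewrite star_val /a; lia.
  by rewrite R_sl pstar pi lsi star_val /b; lia.
case: (eqVneq l (star j)) => [->|h4].
  have -> : Posz (nat_of_ord (star j)) = -1 - b + (1 + k) * n by rewrite star_val /b; lia.
  by rewrite R_sr // pstar pj lsj star_val /a; lia.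
rewrite pout // lam_fix ?pout // R_out ?eqm_ord ?eqm_shiftr ?eqm_ord ?eqm_ord_star //; first lia.
have -> : -1 - b = -1 - Posz (nat_of_ord j) + (- k) * n by rewrite /b; lia.
by rewrite eqm_shiftr eqm_ord_star.
Qed.

Lemma eqm_next c : ~~ eqm c (c + 1).
Proof. by rewrite eqm_near //; lia. Qed.

Lemma R_norm a b t : ~~ eqm a b ->
  R (Posz (nat_of_ord (res a))) (Posz (nat_of_ord (res b)) + (fl 0 b - fl 0 a) * n) t = R a b t.
Proof.
move=> h; rewrite -(R_shift (fl 0 a)).
  by congr R; [rewrite -ord_decomp | rewrite [RHS]ord_decomp; lia].
by rewrite eqm_shiftr eqm_ord res_eqm.
Qed.

Lemma is_reflP w : is_refl w <-> exists a b, ~~ eqm a b /\ forall t, U w t = R a b t.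
Proof.
split.
  move=> [i [j [k [hij /R_reflH h]]]].
  have ne : i != j by apply/eqP => e; move: hij; rewrite e ltnn.
  exists (Posz (nat_of_ord i)), (Posz (nat_of_ord j) + k * n); split; last exact: h.
  by rewrite eqm_shiftr eqm_ord.
move=> [a [b [hab h]]].
wlog hlt : a b hab h / (val (res a) < val (res b))%N.
  move=> wl; case: (ltngtP (val (res a)) (val (res b))) => hv; first exact: (wl a b).
    by apply: (wl b a) => //; [rewrite eqmC | move=> t; rewrite h R_sym].
  by move: hab; rewrite -res_eqm -val_eqE hv eqxx.
exists (res a), (res b), (fl 0 b - fl 0 a); split=> //.
apply: reflH_R; first by rewrite res_eqm.
by move=> t; rewrite h R_norm.
Qed.

Lemma res_val t (j : nat) q : (j < m.*2)%N -> t = Posz j + q * n -> nat_of_ord (res t) = j.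
Proof.
move=> hj ->; have -> : Posz j = Posz (nat_of_ord (Ordinal hj)) by [].
by rewrite (res_eq (eqm_shift _ q)).
Qed.

Lemma is_simpleP w : is_simple w <-> exists c, forall t, U w t = R c (c + 1) t.
Proof.
split.
  move=> [i [j [k [hw hr]]]].
  have ne : i != j.
    apply/eqP => e; case: hw; rewrite e => -[h1 [h2 _]]; rewrite /= in h1 h2; lia.
  have {}hr := R_reflH ne hr.
  case: hw => -[h1 [h2 hk]].
    exists (Posz (nat_of_ord i)) => t; rewrite hr; congr R; rewrite /= in h2; lia.
  (* The affine wall exchanges [0] with [(n - 1) - n = -1]. *)
  exists (-1) => t; rewrite hr R_sym; last by rewrite eqm_shiftr eqm_ord.
  by congr R; rewrite /= in h1 h2; lia.
move=> [c h].
have low c' : (forall t, U w t = R c' (c' + 1) t) -> (nat_of_ord (res c') < m)%N -> is_simple w.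
  move=> h' hlt; have hj : ((res c').+1 < m.*2)%N by lia.
  exists (res c'), (Ordinal hj), 0; split; first by left.
  apply: reflH_R; first by rewrite -val_eqE /=; lia.
  move=> t; rewrite h' -(R_shift (- fl 0 c')) ?eqm_next //.
  by congr R; have := resE c'; rewrite /=; lia.
case: (ltnP (nat_of_ord (res c)) m) => h1; first exact: low h h1.
have hb := ltn_ord (res c).
case: (eqVneq (nat_of_ord (res c)) m.*2.-1) => h2.
  have l0 : (0 < m.*2)%N by lia.
  exists (Ordinal l0), (res c), (-1); split; first by right.
  have ne : Ordinal l0 != res c.
    by apply/eqP => e; move: h2; rewrite -e /=; lia.
  apply: reflH_R => // t.
  rewrite h -(R_shift (- fl 0 c - 1)) ?eqm_next // R_sym.
    by congr R; move: h2; have := resE c; rewrite /=; lia.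
  have -> : c + 1 + (- fl 0 c - 1) * n = c + (- fl 0 c - 1) * n + 1 by lia.
  exact: eqm_next.
(* Exchanging [c] and [c + 1] also exchanges their mirror images [-1 - c] and [-2 - c], which brings
   the pair to the lower half of a period. *)
apply: (low (-2 - c)).
  move=> t; rewrite h -R_dual ?eqm_next // R_sym ?eqm_star ?eqm_next //.
  by congr R; lia.
rewrite (@res_val _ (m.*2 - 2 - nat_of_ord (res c))%N (- 1 - fl 0 c)); [lia|lia|].
by have := resE c; lia.
Qed.

(** * Sums of periodic functions over residues *)

Definition rsum (g : int -> int) : int := \sum_(j : I2) g (Posz (nat_of_ord j)).
Definition periodic (g : int -> int) := forall t q, g (t + q * n) = g t.

Lemma periodic_res g t : periodic g -> g (Posz (nat_of_ord (res t))) = g t.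
Proof. by move=> h; rewrite [in RHS](ord_decomp t) h. Qed.

(** Only the residues moved by [R a b] contribute. If [b] is congruent to [-1 - a], the mirror pair
    is the pair itself and must not be counted twice. *)
Lemma rsum_supp (g : int -> int) a b : periodic g -> ~~ eqm a b ->
  (forall t, R a b t = t -> g t = 0) ->
  rsum g = g a + g b + (if eqm (-1 - a) b then 0 else g (-1 - a) + g (-1 - b)).
Proof.
move=> hp hab h0; rewrite /rsum (bigD1 (res a)) //= periodic_res //.
rewrite (bigD1 (res b)) /=; last by rewrite res_eqm eqmC.
rewrite periodic_res // addrA; congr +%R.
case: ifP => hsd.
  rewrite big1 // => j /andP[h1 h2]; apply: h0; apply: R_out.
  - by rewrite ordE.
  - by rewrite ordE.
  - by rewrite eqmC (eqm_l _ hsd) eqmC ordE.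
  have hsd' : eqm (-1 - b) a by rewrite eqm_starl eqmC.
  by rewrite eqmC (eqm_l _ hsd') eqmC ordE.
rewrite (bigD1 (res (-1 - a))) /=; last first.
  by rewrite !res_eqm hsd andbT eqmC eqm_self_star.
rewrite periodic_res // (bigD1 (res (-1 - b))) /=; last first.
  rewrite !res_eqm eqm_star [eqm b a]eqmC hab andbT eqm_starl eqmC hsd /=.
  by rewrite eqmC eqm_self_star.
rewrite periodic_res // big1 ?addr0 // => j /andP[/andP[/andP[h1 h2] h3] h4].
by apply: h0; apply: R_out; rewrite ordE.
Qed.

Lemma rsum_reindex w g : periodic g -> rsum (fun t => g (U w t)) = rsum g.
Proof.
move=> hp; rewrite /rsum [RHS](reindex_inj (@perm_inj _ (w.2)^-1%g)) /=.
by apply: eq_bigr => j _; rewrite -(periodic_res _ hp) res_U res_ord.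
Qed.

Lemma rsum_le (g g' : int -> int) : (forall t, g t <= g' t) -> rsum g <= rsum g'.
Proof. by move=> h; apply: ler_sum. Qed.

Lemma rsum_lt (g g' : int -> int) t : periodic g -> periodic g' ->
  (forall t, g t <= g' t) -> g t < g' t -> rsum g < rsum g'.
Proof.
move=> hp hp' h ht; rewrite /rsum (bigD1 (res t)) //= [ltRHS](bigD1 (res t)) //=.
by rewrite !periodic_res // ltr_leD // ler_sum.
Qed.

Lemma rsum_sub (g g' : int -> int) : rsum (fun t => g t - g' t) = rsum g - rsum g'.
Proof. by rewrite /rsum sumrB. Qed.

Lemma rsum_add (g g' : int -> int) : rsum (fun t => g t + g' t) = rsum g + rsum g'.
Proof. by rewrite /rsum big_split. Qed.

(** * Length and the exchange property *)

Implicit Types (x y : ew m).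

Lemma U_starE w : inW w -> exists c, forall t, U w (-1 - t) = -1 - U w t + c * n.
Proof. by move=> /inWP[c h]; exists c => t; have := h t; lia. Qed.

(* Strictly increasing along the Bruhat order, and easier to bound than the length. *)
Definition energy w : int := rsum (fun t => (U w t - t) ^+ 2).

Lemma energy_per w : periodic (fun t => (U w t - t) ^+ 2).
Proof. by move=> t q; rewrite U_per; congr (_ ^+ 2); lia. Qed.

Lemma energy_ge0 w : 0 <= energy w.
Proof. by apply: sumr_ge0 => j _; rewrite sqr_ge0. Qed.

(** Rearrangement inequality: the pair [a], [b] adds [2 * (b - a) * (U x b - U x a)], and the mirror
    pair, when distinct, adds the same amount. *)
Lemma energy_swap x y a b : inW x -> a < b -> ~~ eqm a b -> U x a < U x b ->
  (forall t, U y t = U x (R a b t)) -> energy x < energy y.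
Proof.
move=> hW hab ne hU hy; have [c hc] := U_starE hW.
rewrite -subr_gt0 /energy -rsum_sub.
set g := fun t => _; have hg : periodic g.
  by move=> t q; rewrite /g -(energy_per x t q) -(energy_per y t q).
rewrite (rsum_supp hg ne); last by move=> t ht; rewrite /g hy ht subrr.
have e1 : U y a = U x b by rewrite hy R_l0.
have e2 : U y b = U x a by rewrite hy R_r0.
have e3 : U y (-1 - a) = U x (-1 - b).
  by rewrite hy; have := R_sl a b 0; rewrite mul0r !addr0 => ->.
have e4 : U y (-1 - b) = U x (-1 - a).
  by rewrite hy; have := R_sr 0 ne; rewrite mul0r !addr0 => ->.
rewrite /g e1 e2 e3 e4 !hc.
have pos : 0 < (b - a) * (U x b - U x a) by apply: mulr_gt0; lia.
set p := (b - a) * _ in pos.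
have dE : (U x b - a) ^+ 2 - (U x a - a) ^+ 2 + ((U x a - b) ^+ 2 - (U x b - b) ^+ 2)
  = p + p by rewrite /p; ring.
have dE' : (-1 - U x b + c * n - (-1 - a)) ^+ 2 - (-1 - U x a + c * n - (-1 - a)) ^+ 2 +
  ((-1 - U x a + c * n - (-1 - b)) ^+ 2 - (-1 - U x b + c * n - (-1 - b)) ^+ 2)
  = p + p by rewrite /p; ring.
by rewrite dE; case: ifP => _; rewrite ?dE' ?addr0 !addr_gt0.
Qed.

Lemma simple_inW (s : ew m) : is_simple s -> inW s.
Proof. by move=> [i [j [k [_ []]]]]. Qed.

Lemma refl_inW (t : ew m) : is_refl t -> inW t.
Proof. by move=> [i [j [k [_ []]]]]. Qed.

Lemma simple_refl (s : ew m) : is_simple s -> is_refl s.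
Proof.
move=> /is_simpleP[c h]; apply/is_reflP; exists c, (c + 1); split=> //.
exact: eqm_next.
Qed.

Lemma ewprod_inW (ts : seq (ew m)) : (forall u : ew m, u \in ts -> inW u) -> inW (ewprod ts).
Proof.
elim: ts => [|t ts IH] h; first exact: inW1.
apply: inW_mul; first by apply: h; rewrite inE eqxx.
by apply: IH => u hu; apply: h; rewrite inE hu orbT.
Qed.

Lemma lenle_inW w k : lenle w k -> inW w.
Proof.
move=> [ss [_ [h1 [o [ho ->]]]]]; apply: inW_mul; last by case: ho.
by apply: ewprod_inW => s /h1; apply: simple_inW.
Qed.

Lemma exists_simple c : exists s, is_simple s /\ forall t, U s t = R c (c + 1) t.
Proof.
have [s [_ hs]] := exists_R (eqm_next c).
by exists s; split=> //; apply/is_simpleP; exists c.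
Qed.

(** Bubble sort: a simple reflection at a descent of [U w] lowers the energy, and an element without
    descents lies in [Omega]. *)
Lemma lenle_exists w : inW w -> exists k, lenle w k.
Proof.
have [N] := ubnP (absz (energy w)); elim: N w => // N IH w hN hW.
case: (classic (forall t, U w t < U w (t + 1))) => [h|].
  exists 0%N, [::]; split=> //; split=> //; exists w; split; last by rewrite ew1mul.
  exact/inOmegaP.
move=> /not_all_ex_not[c hc].
have {}hc : U w (c + 1) < U w c.
  by case: (ltgtP (U w c) (U w (c + 1))) hc => // /U_inj; lia.
have [s [hs hsE]] := exists_simple c.
have hW' : inW (ewmul s w) by apply: inW_mul => //; apply: simple_inW.
have hQ : energy (ewmul s w) < energy w.
  apply: (@energy_swap _ _ c (c + 1)) => //; [lia | exact: eqm_next | | ].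
    by rewrite !U_mul !hsE R_l0 R_r0 // eqm_next.
  by move=> t; rewrite U_mul hsE RK // eqm_next.
have [|k [ss [hk [hss [o [ho e]]]]]] := IH (ewmul s w) _ hW'.
  by have := energy_ge0 (ewmul s w); lia.
exists k.+1, (s :: ss); split; first by rewrite /=; lia.
split; first by move=> u; rewrite inE => /orP[/eqP->|/hss].
exists o; split=> //; rewrite /= -ewmulA -e.
by apply: U_ext => t; rewrite !U_mul !hsE RK // eqm_next.
Qed.

(** A simple reflection moves each integer by at most one, so the only pairs whose order it reverses
    are the adjacent ones that it exchanges. *)
Lemma R_adjacent c a b : a < b -> ~~ eqm a b -> R c (c + 1) b < R c (c + 1) a ->
  forall t, R c (c + 1) t = R a b t.
Proof.
move=> hab ne h.
have hb : b - 1 <= R c (c + 1) b by case: (RP c (c + 1) b) => *; lia.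
have ha : R c (c + 1) a <= a + 1 by case: (RP c (c + 1) a) => *; lia.
have hne := eqm_next c.
have e : b = a + 1 by lia.
have hup : R c (c + 1) a = a + 1 by lia.
move=> t; rewrite e in ne *.
case: (RP c (c + 1) a) hup ne => [q|q|q|q|u h1 h2 h3 h4] hup ne; try lia.
  by rewrite -(R_shift q) //; congr R; lia.
have hne' : ~~ eqm (-1 - (c + 1)) (-1 - c) by rewrite eqm_star eqmC.
rewrite -[in LHS]R_dual // R_sym ?eqm_star // -(R_shift q) //; congr R; lia.
Qed.

(** Strong exchange. The first letter either reverses [a] and [b], in which case it is the
    reflection itself and is deleted, or it carries the inversion over to the rest of the word. *)
Lemma exchange ss o w a b : (forall s, s \in ss -> is_simple s) -> inOmega o ->
  w = ewmul (ewprod ss) o -> a < b -> ~~ eqm a b -> U w b < U w a ->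
  exists ss', [/\ forall s, s \in ss' -> is_simple s, (size ss' < size ss)%N &
    forall t, U (ewmul (ewprod ss') o) t = U w (R a b t)].
Proof.
move=> hss ho; elim: ss w a b hss => [|s ss IH] w a b hss ew0 hab ne hinv.
  move: hinv; rewrite ew0 /= ew1mul; have [_ ho2] := (inOmegaP o).1 ho.
  by have := increasingP ho2 hab; lia.
have hs : is_simple s by apply: hss; rewrite inE eqxx.
have hss' u : u \in ss -> is_simple u by move=> hu; apply: hss; rewrite inE hu orbT.
have [c hc] := (is_simpleP s).1 hs.
pose w1 := ewmul (ewprod ss) o.
have wE t : U w t = U w1 (R c (c + 1) t) by rewrite ew0 /= -ewmulA U_mul hc.
have ne' : ~~ eqm (R c (c + 1) a) (R c (c + 1) b) by rewrite -!hc U_eqm.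
case: (ltP (R c (c + 1) a) (R c (c + 1) b)) => hR; last first.
  have {}hR : R c (c + 1) b < R c (c + 1) a.
    by move: hR; rewrite le_eqVlt => /orP[/eqP e|//]; rewrite e eqmxx in ne'.
  exists ss; split=> // t; rewrite -/w1 wE (R_adjacent hab ne hR).
  by rewrite RK.
have [|ss' [h1 h2 h3]] := IH w1 _ _ hss' erefl hR ne'; first by rewrite -!wE.
exists (s :: ss'); split.
- by move=> u; rewrite inE => /orP[/eqP->|/h1].
- by rewrite /= ltnS.
move=> t; rewrite /= -ewmulA U_mul hc h3 wE; congr (U w1 _).
by rewrite -!hc (R_conj _ (simple_inW hs)).
Qed.

Lemma lenle_inv w w' a b k : lenle w k -> a < b -> ~~ eqm a b -> U w b < U w a ->
  (forall t, U w' t = U w (R a b t)) -> (0 < k)%N /\ lenle w' k.-1.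
Proof.
move=> [ss [hk [hss [o [ho e]]]]] hab ne hinv hw'.
have [ss' [h1 h2 h3]] := exchange hss ho e hab ne hinv.
have h4 : (size ss' < k)%N := leq_trans h2 hk.
split; first exact: leq_ltn_trans h4.
exists ss'; split; first by case: k h4 {hk}.
by split=> //; exists o; split=> //; apply: U_ext => t; rewrite hw' h3.
Qed.

Definition step x y := inW x /\ exists a b,
  [/\ a < b, ~~ eqm a b, U x a < U x b & forall t, U y t = U x (R a b t)].

Lemma step_inW x y : step x y -> inW y.
Proof.
move=> [hW [a [b [_ ne _ h]]]].
have [r [hr hrE]] := exists_R ne.
have -> : y = ewmul r x by apply: U_ext => t; rewrite U_mul hrE h.
exact: inW_mul.
Qed.

Lemma lenle_le w k k' : (k <= k')%N -> lenle w k -> lenle w k'.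
Proof. by move=> h [ss [h1 h2]]; exists ss; split=> //; apply: leq_trans h1 h. Qed.

Lemma lenle_min w : inW w -> exists k, lenle w k /\ forall k', (k' < k)%N -> ~ lenle w k'.
Proof.
move=> /lenle_exists[k hk]; elim: k {-2}k (leqnn k) hk => [|N IH] k hN hk.
  by exists k; split=> // k'; lia.
case: (classic (exists k', (k' < k)%N /\ lenle w k')) => [[k' [h1 h2]]|h].
  by apply: (IH k') => //; lia.
by exists k; split=> // k' h1 h2; apply: h; exists k'.
Qed.

(** A right factor acts on the values of [U x], so the exchanged values are pulled back to positions
    [a] and [b]. If these carried decreasing values, [exchange] would make [y] shorter than [x]. *)
Lemma bstep_step x y : inW x -> bstep x y -> step x y.
Proof.
move=> hW [t [/is_reflP[a' [b' [ne' ht]]] [ey [k [h1 h2]]]]]; split=> //.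
have [a ha] := U_surj x a'; have [b hb] := U_surj x b'.
have ne : ~~ eqm a b by rewrite -(U_eqm x) ha hb.
have yE u : U y u = U x (R a b u) by rewrite ey U_mul ht (R_conj _ hW ne) ha hb.
wlog hab : a b {ha hb} ne yE / a < b.
  move=> wl; case: (ltgtP a b) => hab; first exact: (wl a b).
    by apply: (wl b a) => //; [rewrite eqmC | move=> u; rewrite yE R_sym].
  by move: ne; rewrite hab eqmxx.
exists a, b; split=> //.
case: (ltgtP (U x a) (U x b)) => // hU; last first.
  by move: ne; rewrite -(U_eqm x) hU eqmxx.
have [_ h3] := lenle_inv h1 hab ne hU yE.
by case: h2; apply: lenle_le h3; lia.
Qed.

(** Deleting a letter from a shortest word of [y], of length [k], writes [x] with at most [k - 1]
    letters, which [y] does not admit. *)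
Lemma step_bstep x y : step x y -> bstep x y.
Proof.
move=> st; have hWy := step_inW st; case: st => [hW [a [b [hab ne hU yE]]]].
have ne' : ~~ eqm (U x a) (U x b) by rewrite U_eqm.
have [t [ht htE]] := exists_R ne'.
exists t; split; first by apply/is_reflP; exists (U x a), (U x b).
split; first by apply: U_ext => u; rewrite U_mul htE yE R_conj.
have [k [h1 h2]] := lenle_min hWy.
have [h3 h4] : (0 < k)%N /\ lenle x k.-1.
  apply: (@lenle_inv y x a b k) => //; first by rewrite !yE R_l0 R_r0.
  by move=> u; rewrite yE RK.
by exists k.-1; split=> //; apply: h2; lia.
Qed.

(** * Bruhat order on cosets *)

Notation steps := (clos_refl_trans (ew m) step).

Lemma steps_inW x y : inW x -> steps x y -> inW y.
Proof. by move=> hW h; elim: h hW => [? ? /step_inW|//|x1 x2 x3 _ h1 _ h2 /h1 /h2]. Qed.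

Lemma energy_step x y : step x y -> energy x < energy y.
Proof. by move=> [hW [a [b [h1 h2 h3 h4]]]]; apply: (energy_swap hW h1 h2 h3 h4). Qed.

Lemma energy_steps x y : steps x y -> energy x <= energy y.
Proof.
elim=> [x1 y1 /energy_step /ltW //|x1 //|x1 x2 x3 _ h1 _ h2]; exact: le_trans h1 h2.
Qed.

Lemma steps_lenle x y k : inW x -> steps x y -> lenle y k -> lenle x k.
Proof.
move=> hW h; elim: h hW => [x1 y1 h1 _ h2|//|x1 x2 x3 h12 IH1 h23 IH2 hW h3].
  have [t [_ [_ [k0 [h3 h4]]]]] := step_bstep h1.
  apply: lenle_le h3; rewrite leqNgt; apply/negP => hk; apply: h4.
  by apply: lenle_le h2; lia.
by apply: IH1 => //; apply: IH2 => //; apply: steps_inW h12.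
Qed.

Lemma ewprod_cat (s1 s2 : seq (ew m)) :
  ewprod (s1 ++ s2) = ewmul (ewprod s1) (ewprod s2).
Proof. by elim: s1 => [|s s1 IH] /=; rewrite ?ew1mul // IH ewmulA. Qed.

Lemma inWa_inW x : inWa x -> inW x.
Proof. by move=> [ts [h ->]]; apply: ewprod_inW => t /h /refl_inW. Qed.

Lemma inWa_step x y : inWa x -> step x y -> inWa y.
Proof.
move=> [ts [hts ->]] /step_bstep[t [ht [-> _]]].
exists (rcons ts t); split.
  by move=> u; rewrite mem_rcons inE => /orP[/eqP->|/hts].
by rewrite -cats1 ewprod_cat /= ewmul1.
Qed.

Lemma step_mulO x y o : step x y -> inOmega o -> step (ewmul x o) (ewmul y o).
Proof.
move=> [hW [a [b [h1 h2 h3 h4]]]] /inOmegaP[hWo ho]; split; first exact: inW_mul.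
exists a, b; split=> //; first by rewrite !U_mul; apply: (increasingP ho).
by move=> t; rewrite !U_mul h4.
Qed.

Lemma steps_mulO x y o : steps x y -> inOmega o -> steps (ewmul x o) (ewmul y o).
Proof.
move=> h ho; elim: h => [x1 y1 h1|x1|x1 x2 x3 _ h1 _ h2].
- exact/rt_step/step_mulO.
- exact: rt_refl.
exact: rt_trans h1 h2.
Qed.

Lemma Wa_Omega w : inW w -> exists x o, [/\ inWa x, inOmega o & w = ewmul x o].
Proof.
move=> /lenle_exists[k [ss [_ [hss [o [ho e]]]]]]; exists (ewprod ss), o; split=> //.
by exists ss; split=> // s /hss /simple_refl.
Qed.

Lemma steps_bruhat x y : inW x -> steps x y -> bruhat x y.
Proof.
move=> hW h; have [x1 [o [hx1 ho e]]] := Wa_Omega hW.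
have h1 : steps x1 (ewmul y (ewinv o)).
  have -> : x1 = ewmul x (ewinv o) by rewrite e -ewmulA ewmulV ewmul1.
  by apply: steps_mulO => //; apply: inOmega_inv.
exists x1, (ewmul y (ewinv o)), o; split=> //.
have hWy : inWa (ewmul y (ewinv o)).
  by elim: h1 hx1 => [? ? h1 h2|//|? ? ? _ h1 _ h2 /h1/h2//]; apply: inWa_step h2 h1.
split=> //; split=> //; split=> //; split; first by rewrite -ewmulA ewVmul ewmul1.
split=> //; split=> //.
elim: (clos_rt_rt1n _ _ _ _ h1) => [z|z1 z2 z3 hz _ IH]; first exact: rt_refl.
by apply: rt_trans IH; apply: rt_step; apply: step_bstep.
Qed.

Lemma bruhat_steps x y : bruhat x y -> inW x /\ steps x y.
Proof.
move=> [x1 [y1 [o [hx [hy [ho [-> [-> [_ [_ h]]]]]]]]]].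
have hWx := inWa_inW hx.
split; first by apply: inW_mul => //; case: ho.
apply: steps_mulO => //.
elim: (clos_rt_rt1n _ _ _ _ h) hWx => [z|z1 z2 z3 hz _ IH] hW; first exact: rt_refl.
have st := bstep_step hW hz.
by apply: rt_trans (IH (step_inW st)); apply: rt_step.
Qed.

(** * Parahoric subgroups and minimal coset representatives *)

Section Parahoric.
Variable I : {set 'I_m.+1}.
Local Notation J i := (inI2m I i).

Lemma inI2mP i : J i <-> exists2 a : 'I_m.+1, a \in I &
  exists q, i = Posz (nat_of_ord a) + q * n \/ i = - Posz (nat_of_ord a) + q * n.
Proof.
split.
  move=> [a [ha h]]; exists a => //.
  case: h => /eqP; rewrite eqz_mod_dvd => /(dvdzP)[q e]; exists q;
    [left|right]; rewrite /= in e; lia.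
move=> [a ha [q h]]; exists a; split=> //.
by case: h => ->; [left|right]; apply/eqP; rewrite eqz_mod_dvd; apply/dvdzP; exists q;
  rewrite /=; lia.
Qed.

Lemma J_per i q : J i -> J (i + q * n).
Proof.
move=> /inI2mP[a ha [q' h]]; apply/inI2mP; exists a => //; exists (q' + q).
by case: h => ->; [left|right]; lia.
Qed.

Lemma J_opp i : J i -> J (- i).
Proof.
move=> /inI2mP[a ha [q' h]]; apply/inI2mP; exists a => //; exists (- q').
by case: h => ->; [right|left]; lia.
Qed.

Lemma inWIP w : inWI I w <-> inW w /\ forall i, J i -> forall t, fl i (U w t) = fl i t.
Proof.
split=> -[hW h]; split=> // i hi.
  move=> t; rewrite (ord_decomp t) U_per !fl_per.
  by have := h i hi (res t); rewrite actE omegaE => ->.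
by move=> j; rewrite actE omegaE h.
Qed.

Lemma inWI_mul w w' : inWI I w -> inWI I w' -> inWI I (ewmul w w').
Proof.
move=> /inWIP[h1 h2] /inWIP[h3 h4]; apply/inWIP; split; first exact: inW_mul.
by move=> i hi t; rewrite U_mul h4 ?h2.
Qed.

Lemma inWI_inv w : inWI I w -> inWI I (ewinv w).
Proof.
move=> /inWIP[h1 h2]; apply/inWIP; split; first exact: inW_inv.
by move=> i hi t; rewrite -h2 // U_invK.
Qed.

Lemma inWI1 : inWI I (ew1 m).
Proof. by apply/inWIP; split; [exact: inW1 | move=> i hi t; rewrite U_1]. Qed.

(** [a] and [b] lie in the same gap between consecutive elements of [J]; exchanging them then gives
    an element of the parahoric subgroup. *)
Definition Jeq a b := forall i, J i -> fl i a = fl i b.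

Lemma fl_starr i t : fl i (-1 - t) = -1 - fl (- i) t.
Proof. by rewrite -[in LHS](opprK i) fl_star. Qed.

Lemma R_Jeq a b i t : Jeq a b -> J i -> fl i (R a b t) = fl i t.
Proof.
move=> h hi; have hi' := J_opp hi.
by case: (RP a b t) => *; rewrite ?fl_per ?fl_starr ?(h _ hi) ?(h _ hi').
Qed.

Lemma R_inWI a b w : Jeq a b -> inW w -> (forall t, U w t = R a b t) -> inWI I w.
Proof. by move=> h hW hR; apply/inWIP; split=> // i hi t; rewrite hR R_Jeq. Qed.

Lemma incosetxx x : incoset I x x.
Proof. by exists (ew1 m); split; [exact: inWI1 | rewrite ewmul1]. Qed.

Lemma incoset_trans x y z : incoset I x y -> incoset I y z -> incoset I x z.
Proof.
move=> [v [hv ->]] [v' [hv' ->]]; exists (ewmul v v'); split; first exact: inWI_mul.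
by rewrite ewmulA.
Qed.

Lemma incoset_sym x y : incoset I x y -> incoset I y x.
Proof.
move=> [v [hv ->]]; exists (ewinv v); split; first exact: inWI_inv.
by rewrite -ewmulA ewmulV ewmul1.
Qed.

(** When [s] exchanges [c] and [c + 1], this is the smaller of [x] and [ewmul x s] in the Bruhat
    order. *)
Definition lowered c s x :=
  if U (ewinv x) c < U (ewinv x) (c + 1) then x else ewmul x s.

Lemma step_simple c s x : inW x -> is_simple s -> (forall t, U s t = R c (c + 1) t) ->
  if U (ewinv x) c < U (ewinv x) (c + 1) then step x (ewmul x s) else step (ewmul x s) x.
Proof.
move=> hW hs hc; have hne := eqm_next c.
set a := U (ewinv x) c; set b := U (ewinv x) (c + 1).
have ha : U x a = c by rewrite U_invK.
have hb : U x b = c + 1 by rewrite U_invK.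
have ne : ~~ eqm a b by rewrite -(U_eqm x) ha hb.
have xsE t : U (ewmul x s) t = U x (R a b t) by rewrite U_mul hc R_conj // ha hb.
case: ltP => hab.
  by split=> //; exists a, b; split=> //; rewrite ha hb; lia.
have {}hab : b < a by move: hab; rewrite le_eqVlt => /orP[/eqP e|//]; rewrite e eqmxx in ne.
split; first by apply: inW_mul => //; apply: simple_inW.
exists b, a; rewrite eqmC; split=> //.
  by rewrite !xsE R_l0 R_r0 // ha hb; lia.
by move=> t; rewrite xsE -(R_sym _ ne) RK.
Qed.

Lemma lowered_steps c s x : inW x -> is_simple s -> (forall t, U s t = R c (c + 1) t) ->
  steps (lowered c s x) x.
Proof.
move=> hW hs hc; rewrite /lowered; have := step_simple hW hs hc.
by case: ifP => _ h; [apply: rt_refl | apply: rt_step].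
Qed.

(** By [R_adjacent], [s] reverses the values [U x a < U x b] only if it is itself the reflection
    relating [x] to [y]. *)
Lemma step_right c s x y : is_simple s -> (forall t, U s t = R c (c + 1) t) ->
  step x y -> y = ewmul x s \/ step (ewmul x s) (ewmul y s).
Proof.
move=> hs hc [hW [a [b [hab ne hU yE]]]].
have ne' : ~~ eqm (U x a) (U x b) by rewrite U_eqm.
case: (ltP (R c (c + 1) (U x a)) (R c (c + 1) (U x b))) => hR.
  right; split; first by apply: inW_mul => //; apply: simple_inW.
  by exists a, b; split=> //; rewrite ?U_mul ?hc // => t; rewrite !U_mul yE.
left; have {}hR : R c (c + 1) (U x b) < R c (c + 1) (U x a).
  move: hR; rewrite le_eqVlt => /orP[/eqP /(R_inj (eqm_next c)) e|//].
  by rewrite e eqmxx in ne'.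
apply: U_ext => t; rewrite U_mul hc yE (R_conj _ hW ne).
by rewrite (R_adjacent hU ne' hR).
Qed.

(* The lifting property of the Bruhat order. *)
Lemma lowered_mono c s x y : inW x -> is_simple s -> (forall t, U s t = R c (c + 1) t) ->
  steps x y -> steps (lowered c s x) (lowered c s y).
Proof.
move=> hW hs hc h; elim: h hW => [x1 y1 st hW|z _|x1 x2 x3 h12 IH1 h23 IH2 hW]; last 2 first.
- exact: rt_refl.
- by apply: rt_trans (IH1 hW) (IH2 _); apply: steps_inW h12.
have hWy := step_inW st.
have sx := step_simple hW hs hc; have sy := step_simple hWy hs hc.
have ssK z : ewmul (ewmul z s) s = z.
  by apply: U_ext => t; rewrite !U_mul !hc RK // eqm_next.
rewrite /lowered.
move: sx sy; case: ifP => _ sx; case: ifP => _ sy.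
- exact: rt_step.
- case: (step_right hs hc st) => [->|st2]; first by rewrite ssK; apply: rt_refl.
  by apply: rt_trans (rt_step _ _ _ _ sx) (rt_step _ _ _ _ st2).
- by apply: rt_trans (rt_step _ _ _ _ sx) (rt_step _ _ _ _ st).
(* Here [ewmul x1 s] lies below [x1], so it cannot be [y1], which lies above. *)
case: (step_right hs hc st) => [e|st2]; last exact: rt_step.
by rewrite e in st; have := energy_step st; have := energy_step sx; lia.
Qed.

(** The inverse of [U x] increases on every gap of [J]. These elements turn out to be the minimal
    representatives of their cosets. *)
Definition Jsorted x := forall c, Jeq c (c + 1) -> U (ewinv x) c < U (ewinv x) (c + 1).

Lemma lowered_incoset c s x : Jeq c (c + 1) -> is_simple s ->
  (forall t, U s t = R c (c + 1) t) -> incoset I x (lowered c s x).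
Proof.
move=> hJ hs hc; rewrite /lowered; case: ifP => _; first exact: incosetxx.
by exists s; split=> //; apply: (R_inWI hJ) => //; apply: simple_inW.
Qed.

(** Both elements are lowered by the same simple reflections of the parahoric subgroup; the lifting
    property preserves their comparison, and the energy bounds the process. *)
Lemma sort_pair x y : inW x -> steps x y -> exists x' y',
  [/\ Jsorted x' /\ Jsorted y', incoset I x x', incoset I y y', steps x' y' &
      steps x' x /\ steps y' y].
Proof.
have [N] := ubnP (absz (energy x + energy y)); elim: N x y => // N IH x y hN hW h.
case: (classic (Jsorted x /\ Jsorted y)) => [hs|hs].
  by exists x, y; split=> //; try exact: incosetxx; split; apply: rt_refl.
have hWy := steps_inW hW h.
have [c [hJ hc]] : exists c, Jeq c (c + 1) /\
    (~~ (U (ewinv x) c < U (ewinv x) (c + 1)) \/ ~~ (U (ewinv y) c < U (ewinv y) (c + 1))).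
  apply: NNPP => hn; apply: hs; split=> c hJ; apply/negPn/negP => hc; apply: hn; exists c.
    by split=> //; left.
  by split=> //; right.
have [s [hs' hsc]] := exists_simple c.
have sx := step_simple hW hs' hsc; have sy := step_simple hWy hs' hsc.
have lx := lowered_steps hW hs' hsc; have ly := lowered_steps hWy hs' hsc.
have hQ : energy (lowered c s x) + energy (lowered c s y) < energy x + energy y.
  have qx := energy_steps lx; have qy := energy_steps ly.
  case: hc => hc; [move: sx|move: sy]; move: qx qy;
    rewrite /lowered (negbTE hc) => qx qy /energy_step; lia.
have hWl : inW (lowered c s x).
  by rewrite /lowered; case: ifP => // _; apply: inW_mul => //; apply: simple_inW.
have [|x' [y' [h1 h2 h3 h4 [h5 h6]]]] :=
  IH (lowered c s x) (lowered c s y) _ hWl (lowered_mono hW hs' hsc h).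
  by have := energy_ge0 (lowered c s x); have := energy_ge0 (lowered c s y); lia.
exists x', y'; split=> //.
- by apply: incoset_trans h2; apply: lowered_incoset.
- by apply: incoset_trans h3; apply: lowered_incoset.
by split; [apply: rt_trans h5 lx | apply: rt_trans h6 ly].
Qed.

Lemma Jsorted_lt x a b : Jsorted x -> Jeq (U x a) (U x b) -> U x a < U x b -> a < b.
Proof.
move=> hs hJ hab.
rewrite -(U_Kinv x a) -(U_Kinv x b); move: (U x a) (U x b) hJ hab => c d hJ hcd.
have -> : d = c + Posz (absz (d - c)) by lia.
have : (0 < absz (d - c)%R)%N by lia.
have : c + Posz (absz (d - c)) <= d by lia.
elim: (absz (d - c)) => // k IH hk _.
have hJ' : Jeq (c + Posz k) (c + Posz k.+1).
  move=> i hi; have e := hJ i hi.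
  have := @fl_mono i c (c + Posz k) ltac:(lia).
  have := @fl_mono i (c + Posz k) (c + Posz k.+1) ltac:(lia).
  have := @fl_mono i (c + Posz k.+1) d ltac:(lia); lia.
have hk1 : U (ewinv x) (c + Posz k) < U (ewinv x) (c + Posz k.+1).
  have e : c + Posz k.+1 = c + Posz k + 1 by lia.
  by rewrite e; apply: hs; rewrite -e.
case: k IH hk hJ' hk1 => [|k] IH hk hJ' hk1; first by rewrite addr0 in hk1.
by apply: lt_trans hk1; apply: IH => //; lia.
Qed.

Hypothesis I0 : I != set0.

Lemma J_ex : exists i, J i.
Proof.
have [a ha] := set0Pn _ I0; exists (Posz (nat_of_ord a)); apply/inI2mP; exists a => //.
by exists 0; left; lia.
Qed.

(** [U z] increases across gaps because [z] preserves each gap, and inside a gap because both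
    elements are sorted. It is thus a shift, and one that preserves the gaps, hence the identity. *)
Lemma Jsorted_unique x z : inWI I z -> Jsorted x -> Jsorted (ewmul x z) -> z = ew1 m.
Proof.
move=> /inWIP[hW hz] hx hxz.
have inc t : U z t < U z (t + 1).
  case: (classic (Jeq t (t + 1))) => hJ; last first.
    have [i] := not_all_ex_not _ _ hJ.
    move=> hi; have [hi1 hi2] := imply_to_and _ _ hi.
    apply: (@fl_lt i); rewrite !hz //.
    by have := @fl_mono i t (t + 1) ltac:(lia); lia.
  case: (ltgtP (U z t) (U z (t + 1))) => // hU; last by have := U_inj hU; lia.
  have [a ha] := U_surj x t; have [b hb] := U_surj x (t + 1).
  have hab : a < b by apply: (Jsorted_lt hx); rewrite ?ha ?hb //; lia.
  have hba : b < a.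
    apply: (Jsorted_lt hxz); rewrite !U_mul ha hb //.
    by move=> i hi; rewrite !hz // hJ.
  lia.
have [r hr] := U_shift inc.
have [i hi] := J_ex.
have h1 := hz i hi i; have h2 := hz i hi (i - 1); rewrite !hr in h1 h2.
have e1 : fl i i = 0 by apply: fl_uniq; lia.
have e2 : fl i (i - 1) = -1 by apply: fl_uniq; lia.
rewrite e1 in h1; rewrite e2 in h2.
have b1 := fl_bounds i (i + r); have b2 := fl_bounds i (i - 1 + r).
rewrite h1 in b1; rewrite h2 in b2.
by apply: U_ext => t; rewrite hr U_1; lia.
Qed.

(** Sorting [y] goes down in the Bruhat order and, by uniqueness, ends at [x]. *)
Lemma Jsorted_min x y k : inW x -> Jsorted x -> incoset I x y -> lenle y k -> lenle x k.
Proof.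
move=> hW hx hxy hk; have hWy := lenle_inW hk.
have [y' [_ [[hy' _] h2 _ _ [h5 _]]]] := sort_pair hWy (rt_refl _ _ y).
have [z [hz e]] := incoset_trans hxy h2.
have e1 : z = ew1 m by apply: (Jsorted_unique hz hx); rewrite -e.
rewrite e1 ewmul1 in e; rewrite -e; apply: steps_lenle h5 hk.
by rewrite e.
Qed.

Lemma steps_coset_le w x y : inW w -> incoset I w x -> steps x y -> coset_le I w y.
Proof.
move=> hW hwx hxy; have hWx : inW x.
  by case: hwx => v [[hv _] ->]; apply: inW_mul.
have [x' [y' [[hs1 hs2] h2 h3 h4 _]]] := sort_pair hWx hxy.
have inWc z z' : inW z -> incoset I z z' -> inW z'.
  by move=> hz [v [[hv _] ->]]; apply: inW_mul.
have hWy : inW y := steps_inW hWx hxy.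
exists x', y'; split; [|split].
- split; first exact: incoset_trans hwx h2.
  move=> v hv k; apply: Jsorted_min => //; first exact: inWc h2.
  by apply: incoset_trans hv; apply: incoset_sym; apply: incoset_trans hwx h2.
- split=> // v hv k; apply: Jsorted_min => //; first exact: inWc h3.
  by apply: incoset_trans hv; apply: incoset_sym.
by apply: steps_bruhat => //; apply: inWc h2.
Qed.

Lemma coset_le_steps w y : coset_le I w y -> exists x y',
  [/\ incoset I w x, incoset I y y', inW x & steps x y'].
Proof.
move=> [x [y' [[h1 _] [[h2 _] /bruhat_steps[h3 h4]]]]].
by exists x, y'.
Qed.

End Parahoric.

(** * Permissibility descends along the Bruhat order *)

(* [disp w i] is the vector [w omega_i - omega_i], indexed by [int] with period [n]. *)
Definition disp w i t : int := fl i (U w t) - fl i t.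

Lemma disp_per w i : periodic (disp w i).
Proof. by move=> t q; rewrite /disp U_per !fl_per; lia. Qed.

Definition zeros w i : int := rsum (fun t => Posz (disp w i t == 0)).

Lemma zeros_per w i : periodic (fun t => Posz (disp w i t == 0)).
Proof. by move=> t q; rewrite disp_per. Qed.

Definition perm_at (s : nat) w i :=
  [/\ forall t, 0 <= disp w i t <= 2, rsum (disp w i) = n & zeros w i <= Posz s].

Lemma card_sum (P : pred I2) : Posz #|[set j | P j]| = \sum_j Posz (P j).
Proof.
rewrite -sum1_card big_mkcond /= (big_morph Posz PoszD (erefl _)).
by apply: eq_bigr => j _; rewrite inE; case: (P j).
Qed.

Lemma wedgeP s (I : {set 'I_m.+1}) w :
  wedge_permissible s I w <-> forall i, inI2m I i -> perm_at s w i.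
Proof.
have dE i (j : I2) : Defs.act w (omega i) j - omega i j = disp w i (Posz (nat_of_ord j)).
  by rewrite actE omegaE.
have zE i : Posz #|[set j : I2 | Defs.act w (omega i) j - omega i j == 0]| = zeros w i.
  by rewrite card_sum; apply: eq_bigr => j _; rewrite dE.
split=> h i hi; have := h i hi.
  move=> /= [h1 [h2 h3]]; split.
  - by move=> t; rewrite -(periodic_res t (disp_per w i)) -dE.
  - by rewrite -h2; apply: eq_bigr => j _; rewrite dE.
  by rewrite -zE lez_nat.
move=> [h1 h2 h3] /=; split; first by move=> j; rewrite dE.
split; last by rewrite -lez_nat zE.
by rewrite -h2; apply: eq_bigr => j _; rewrite dE.
Qed.

Lemma disp_coset I x y i t : incoset I x y -> inI2m I i -> disp y i t = disp x i t.
Proof. by move=> [z [/inWIP[_ hz] ->]] hi; rewrite /disp U_mul hz. Qed.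

Lemma perm_at_ext s x y i :
  (forall t, disp y i t = disp x i t) -> perm_at s x i -> perm_at s y i.
Proof.
move=> h [h1 h2 h3]; split; first by move=> t; rewrite h.
  by rewrite -h2; apply: eq_bigr => j _; rewrite h.
by have -> : zeros y i = zeros x i by apply: eq_bigr => j _; rewrite h.
Qed.

Lemma perm_at_coset s I x y i : incoset I x y -> inI2m I i -> perm_at s x i -> perm_at s y i.
Proof. by move=> h hi; apply: perm_at_ext => t; apply: disp_coset h hi. Qed.

Lemma R_image x y a b : ~~ eqm a b -> (forall t, U y t = U x (R a b t)) ->
  [/\ U y a = U x b, U y b = U x a, U y (-1 - a) = U x (-1 - b) &
      U y (-1 - b) = U x (-1 - a)].
Proof.
move=> ne h; rewrite !h R_l0 R_r0 //.
by have := R_sl a b 0; have := R_sr 0 ne; rewrite mul0r !addr0 => -> ->.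
Qed.

(** The two entries of [x] lie between those of [y] and have the same sum. A zero among them forces
    a zero in [y], and two zeros force two. *)
Lemma disp_swap_pair x y i p q : p < q -> U x p < U x q -> U y p = U x q -> U y q = U x p ->
  0 <= disp y i p <= 2 -> 0 <= disp y i q <= 2 ->
  [/\ 0 <= disp x i p <= 2, 0 <= disp x i q <= 2,
      disp x i p + disp x i q = disp y i p + disp y i q &
      Posz (disp x i p == 0) + Posz (disp x i q == 0) <=
      Posz (disp y i p == 0) + Posz (disp y i q == 0)].
Proof.
rewrite /disp => h1 h2 -> ->; have := fl_mono i (ltW h1); have := fl_mono i (ltW h2).
move: (fl i p) (fl i q) (fl i (U x p)) (fl i (U x q)) => A B C E *.
split; lia.
Qed.

Lemma perm_at_step s x y i : step x y -> perm_at s y i -> perm_at s x i.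
Proof.
move=> [hW [a [b [hab ne hU yE]]]] [h1 h2 h3].
have [e1 e2 e3 e4] := R_image ne yE.
have [c hc] := U_starE hW.
have [d1 d2 d3 d4] := disp_swap_pair hab hU e1 e2 (h1 a) (h1 b).
have hU' : U x (-1 - b) < U x (-1 - a) by rewrite !hc; lia.
have hst : -1 - b < -1 - a by lia.
have [d5 d6 d7 d8] := disp_swap_pair hst hU' e4 e3 (h1 _) (h1 _).
have fixE t : R a b t = t -> disp x i t = disp y i t by move=> h; rewrite /disp yE h.
split.
- move=> t; case: (RP a b t) (fixE t) => [q|q|q|q|u h h' h'' h''']; rewrite ?disp_per => h0 //.
  by rewrite h0 // R_out.
- rewrite -h2; apply/eqP; rewrite -subr_eq0 -rsum_sub (rsum_supp _ ne); last first.
  + by move=> t h; rewrite fixE ?subrr.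
  + by move=> t q; rewrite !disp_per.
  by case: ifP => _; apply/eqP; clear - d3 d7; lia.
apply: le_trans h3; rewrite -subr_le0 -rsum_sub (rsum_supp _ ne); last first.
- by move=> t h; rewrite fixE ?subrr.
- by move=> t q; rewrite !disp_per.
by case: ifP => _; clear - d4 d8; lia.
Qed.

Lemma perm_at_steps s x y i : steps x y -> perm_at s y i -> perm_at s x i.
Proof. by elim=> [x1 y1 /perm_at_step h /h|//|x1 x2 x3 _ h1 _ h2 /h2/h1]. Qed.

Lemma sum_three s (A B C : int) : (s <= m)%N ->
  \sum_(j : I2) (if (j < s)%N then A else if (j < m.*2 - s)%N then B else C)
  = A * Posz s + B * (n - 2 * Posz s) + C * Posz s.
Proof.
move=> hs; pose f j := if (j < s)%N then A else if (j < m.*2 - s)%N then B else C.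
rewrite -(big_mkord xpredT f) (big_cat_nat _ (n := s)) /=; [|lia|lia].
rewrite (big_cat_nat _ (n := (m.*2 - s)%N) (m := s)) /=; [|lia|lia].
rewrite (eq_big_nat _ _ (F2 := fun _ => A)); last first.
  by move=> j /andP[_ h]; rewrite /f h.
rewrite [X in _ + (X + _)](eq_big_nat _ _ (F2 := fun _ => B)); last first.
  by move=> j /andP[h h']; rewrite /f h' ltnNge h.
rewrite [X in _ + (_ + X)](eq_big_nat _ _ (F2 := fun _ => C)); last first.
  move=> j /andP[h h']; rewrite /f [(j < _ - _)%N]ltnNge h ltnNge.
  by rewrite (_ : (s <= j)%N) //; lia.
rewrite !sumr_const_nat !pmulrn !mulrzz subn0 subKn; last by lia.
have -> : Posz (m.*2 - s - s)%N = n - 2 * Posz s by lia.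
by rewrite addrA.
Qed.

Lemma U_trans (lam : I2 -> int) t : U (trans lam) t = t + lam (res t) * n.
Proof. by rewrite UE /= invg1 perm1 ffunE resE; ring. Qed.

Lemma perm_at_trans s (sg : {perm I2}) i : (s <= m)%N ->
  perm_at s (trans (permvec sg (mu s))) i.
Proof.
move=> hs; set lam := permvec sg _.
have dE t : disp (trans lam) i t = lam (res t) by rewrite /disp U_trans fl_per; lia.
have re (g : I2 -> int) : \sum_(j : I2) g ((sg^-1)%g (res (Posz (nat_of_ord j)))) = \sum_j g j.
  rewrite [RHS](reindex_inj (@perm_inj _ (sg^-1)%g)) /=.
  by apply: eq_bigr => j _; rewrite res_ord.
split.
- by move=> t; rewrite dE /lam /permvec /mu; case: ifP => _ //; case: ifP.
- rewrite /rsum (eq_bigr _ (fun j _ => dE _)) (re (mu s)).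
  by rewrite (sum_three 2 1 0 hs); lia.
rewrite /zeros /rsum.
rewrite (eq_bigr (fun j : I2 => Posz (mu s ((sg^-1)%g (res (Posz (nat_of_ord j)))) == 0))).
  rewrite (re (fun j => Posz (mu s j == 0))).
  rewrite (eq_bigr (fun j : I2 => if (j < s)%N then 0 else if (j < m.*2 - s)%N then 0 else 1)).
    by rewrite sum_three //; lia.
  by move=> j _; rewrite /mu; case: ifP => // _; case: ifP.
by move=> j _; rewrite dE.
Qed.

Lemma admissible_permissible s (I : {set 'I_m.+1}) w :
  (s <= m)%N -> admissible s I w -> wedge_permissible s I w.
Proof.
move=> hs [sg [_ /coset_le_steps[x [y [h1 h2 _ h3]]]]]; apply/wedgeP => i hi.
apply: (@perm_at_coset s I x w i) => //; first exact: incoset_sym h1.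
apply: perm_at_steps h3 _; apply: perm_at_coset h2 hi _.
exact: perm_at_trans.
Qed.

(** * Permissible elements that are not extreme translations can be raised *)

Lemma rsum_star g : periodic g -> rsum (fun t => g (-1 - t)) = rsum g.
Proof.
move=> hp; rewrite /rsum [RHS](reindex_inj (inv_inj starK)) /=.
apply: eq_bigr => j _; rewrite star_val -[RHS](hp _ (-1)); congr g; lia.
Qed.

(** The linear part only permutes the values of [fl i], so the sum condition does not depend on
    [i]. *)
Lemma rsum_D w i : rsum (disp w i) = \sum_j w.1 j.
Proof.
rewrite /rsum (eq_bigr (fun j : I2 => w.1 j +
   (fl i (Posz (nat_of_ord ((w.2)^-1%g j))) - fl i (Posz (nat_of_ord j))))); last first.
  by move=> j _; rewrite /disp U_ord fl_per; lia.
rewrite big_split sumrB /=.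
rewrite [X in _ + (_ - X)](reindex_inj (@perm_inj _ (w.2)^-1%g)) /=.
by rewrite subrr addr0.
Qed.

Lemma rsum_const c : rsum (fun _ => c) = c * n.
Proof. by rewrite /rsum sumr_const card_ord pmulrn mulrzz. Qed.

(* The similitude factor is 2, as forced by permissibility. *)
Definition level2 w := forall t, U w (-1 - t) = -1 - U w t + 2 * n.

Lemma level2_inW w : level2 w -> inW w.
Proof. by move=> h; apply/inWP; exists 2 => t; rewrite h; lia. Qed.

(** The entries at [-i] are [c] minus those at [i]. Both families sum to [n], so [c * n - n = n]. *)
Lemma perm_at_level2 s w i : inW w -> perm_at s w i -> level2 w.
Proof.
move=> /U_starE[c hc] [_ h _].
have dE t : disp w (- i) (-1 - t) = c - disp w i t.
  by rewrite /disp hc fl_per !fl_star; lia.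
have := rsum_star (disp_per w (- i)); rewrite rsum_D -(rsum_D w i) h.
have -> : rsum (fun t => disp w (- i) (-1 - t)) = rsum (fun t => c - disp w i t).
  by apply: eq_bigr => j _; rewrite dE.
rewrite rsum_sub rsum_const h => e.
have e2 : (c - 2) * n = 0 by lia.
have /eqP := e2; rewrite mulf_eq0 (negbTE n_neq0) orbF => /eqP e3.
by move=> t; rewrite hc; have -> : c = 2 by lia.
Qed.

Lemma disp_star w i t : level2 w -> disp w (- i) (-1 - t) = 2 - disp w i t.
Proof. by move=> h; rewrite /disp h fl_per !fl_star; lia. Qed.

(** The entries are 0, 1 or 2 and their mean is 1. *)
Lemma twos_zeros s w i : perm_at s w i -> rsum (fun t => Posz (disp w i t == 2)) = zeros w i.
Proof.
move=> [h1 h2 _]; apply/eqP; rewrite -subr_eq0 -rsum_sub.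
have -> : rsum (fun t => Posz (disp w i t == 2) - Posz (disp w i t == 0)) =
          rsum (fun t => disp w i t - 1).
  by apply: eq_bigr => j _; have := h1 (Posz (nat_of_ord j)); lia.
by rewrite rsum_sub rsum_const h2; apply/eqP; lia.
Qed.

Lemma perm_at_opp s w i : level2 w -> perm_at s w i ->
  perm_at s w (- i) /\ zeros w (- i) = zeros w i.
Proof.
move=> h2 hp; have [h3 h4 h5] := hp.
have zE : zeros w (- i) = zeros w i.
  rewrite -(twos_zeros hp) [LHS]/zeros -(rsum_star (zeros_per w (- i))).
  apply: eq_bigr => j _; rewrite disp_star //; congr Posz; congr nat_of_bool.
  by apply/eqP/eqP; lia.
split=> //; split; last by rewrite zE.
  move=> t; have -> : t = -1 - (-1 - t) by lia.
  by rewrite disp_star //; have := h3 (-1 - t); lia.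
by rewrite rsum_D -(rsum_D w i).
Qed.

Lemma disp_peri w i t q : disp w (i + q * n) t = disp w i t.
Proof. by rewrite /disp !fl_peri; lia. Qed.

Lemma perm_at_peri s w i q : perm_at s w i -> perm_at s w (i + q * n).
Proof.
move=> [h1 h2 h3]; split; first by move=> t; rewrite disp_peri.
  by rewrite rsum_D -(rsum_D w i).
by have -> : zeros w (i + q * n) = zeros w i by apply: eq_bigr => j _; rewrite disp_peri.
Qed.

Section Ascent.
Variables (s : nat) (w : ew m).
Hypothesis Hs : (s <= m)%N.
Hypothesis Hw : level2 w.
Hypothesis Hp : forall i, perm_at s w i.

(* Permissibility at every [i] amounts to [|V t - t| <= n] together with: at most [s] of the
   intervals [(V t, t]] with [V t < t] contain [i] (equivalently, at most [s] of the intervals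
   [(t, V t]] with [t < V t]). *)
Definition V t := U w t - n.

Lemma V_per t q : V (t + q * n) = V t + q * n.
Proof. by rewrite /V U_per; lia. Qed.

Lemma V_eqm a b : eqm (V a) (V b) = eqm a b.
Proof.
rewrite -[RHS](U_eqm w); apply/eqmP/eqmP => -[q h]; exists q; move: h; rewrite /V; lia.
Qed.

Lemma V_surj t : exists a, V a = t.
Proof. by have [a ha] := U_surj w (t + n); exists a; rewrite /V ha; lia. Qed.

Lemma V_star t : V (-1 - t) = -1 - V t.
Proof. by rewrite /V Hw; lia. Qed.

Lemma fl_U i t : fl i (U w t) = fl i (V t) + 1.
Proof. by rewrite -fl_per /V; congr fl; lia. Qed.

(** The bound on [disp] is used at [i = t + 1], the first vertex above [t], where it is sharpest;
    the lower bound below uses [i = t]. *)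
Lemma V_le t : V t <= t + n.
Proof.
have [h _ _] := Hp (t + 1); have := h t; rewrite /disp fl_U.
have -> : fl (t + 1) t = -1 by apply: fl_uniq; lia.
by have := fl_ge (t + 1) (V t) 1; lia.
Qed.

Lemma V_ge t : t - n <= V t.
Proof.
have [h _ _] := Hp t; have := h t; rewrite /disp fl_U.
have -> : fl t t = 0 by apply: fl_uniq; lia.
by have := fl_ge t (V t) (-1); lia.
Qed.

Definition N i := zeros w i.

Lemma N_per i q : N (i + q * n) = N i.
Proof. by apply: eq_bigr => j _; rewrite disp_peri. Qed.

Lemma N_opp i : N (- i) = N i.
Proof. by have [] := perm_at_opp Hw (Hp i). Qed.

Lemma N_le i : N i <= Posz s.
Proof. by have [] := Hp i. Qed.

(* Exchanging the values of [V] at [a < b] raises [N] exactly on the translates of the interval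
   [(max a (V a), min b (V b)]]. *)
Definition raises a b i := [&& fl i a == fl i (V a), fl i a < fl i b & fl i b == fl i (V b)].

Lemma raises_star a b i : raises (-1 - b) (-1 - a) i = raises a b (- i).
Proof.
rewrite /raises !V_star !fl_starr.
by apply/and3P/and3P => -[/eqP h1 h2 /eqP h3]; split; try apply/eqP; lia.
Qed.

(** The bounds [V q <= p + n] and [q <= V p + n] keep the new entries between 0 and 2. *)
Lemma disp_raise_pair y i p q : p < q -> V p < V q -> V q <= p + n -> q <= V p + n ->
  U y p = U w q -> U y q = U w p ->
  [/\ 0 <= disp y i p <= 2, 0 <= disp y i q <= 2,
      disp y i p + disp y i q = disp w i p + disp w i q &
      Posz (disp y i p == 0) + Posz (disp y i q == 0) <=
      Posz (disp w i p == 0) + Posz (disp w i q == 0) + Posz (raises p q i)].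
Proof.
move=> h1 h2 h3 h4 e1 e2.
have [hD _ _] := Hp i; have := hD p; have := hD q.
rewrite /raises /disp e1 e2 !fl_U.
have := fl_mono i (ltW h1); have := fl_mono i (ltW h2).
have := fl_mono i h3; have := fl_mono i h4.
have -> : fl i (p + n) = fl i p + 1 by rewrite -fl_per; congr fl; lia.
have -> : fl i (V p + n) = fl i (V p) + 1 by rewrite -fl_per; congr fl; lia.
move: (fl i p) (fl i q) (fl i (V p)) (fl i (V q)) => A B C E *.
split; lia.
Qed.

(** The last summand accounts for the mirror pair, when it is distinct from the pair itself. *)
Lemma ascent y a b : a < b -> ~~ eqm a b -> V a < V b -> V b <= a + n -> b <= V a + n ->
  (forall t, U y t = U w (R a b t)) ->
  (forall i, N i + Posz (raises a b i) +
     (if eqm (-1 - a) b then 0 else Posz (raises a b (- i))) <= Posz s) ->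
  forall i, perm_at s y i.
Proof.
move=> hab ne hV hb1 hb2 yE hN i.
have [e1 e2 e3 e4] := R_image ne yE.
have [d1 d2 d3 d4] := disp_raise_pair i hab hV hb1 hb2 e1 e2.
have [d5 d6 d7 d8] : [/\ 0 <= disp y i (-1 - b) <= 2, 0 <= disp y i (-1 - a) <= 2,
    disp y i (-1 - b) + disp y i (-1 - a) = disp w i (-1 - b) + disp w i (-1 - a) &
    Posz (disp y i (-1 - b) == 0) + Posz (disp y i (-1 - a) == 0) <=
    Posz (disp w i (-1 - b) == 0) + Posz (disp w i (-1 - a) == 0) + Posz (raises a b (- i))].
  by rewrite -raises_star; apply: disp_raise_pair => //; rewrite ?V_star; lia.
have fixE t : R a b t = t -> disp y i t = disp w i t by move=> h; rewrite /disp yE h.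
have [h1 h2 _] := Hp i.
split.
- move=> t; case: (RP a b t) (fixE t) => [q|q|q|q|u h h' h'' h''']; rewrite ?disp_per => h0 //.
  by rewrite h0 // R_out.
- rewrite -h2; apply/eqP; rewrite -subr_eq0 -rsum_sub (rsum_supp _ ne);
    [case: ifP => _; apply/eqP; clear - d3 d7; lia | by move=> t q; rewrite !disp_per
    | by move=> t h; rewrite fixE ?subrr].
apply: le_trans (hN i); rewrite -addrA addrC -lerBlDr -rsum_sub (rsum_supp _ ne).
- by case: ifP => _; clear - d4 d8; lia.
- by move=> t q; rewrite !disp_per.
by move=> t h; rewrite fixE ?subrr.
Qed.

(** An interval [(V t, t]] has length at most [n], so [N i] counts those that contain [i]. By
    [twos_zeros] it equally counts the ascending intervals [(t, V t]] that contain [i]. *)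
Lemma coverP i t : disp w i t = 0 <-> exists q, V t < i + q * n <= t.
Proof.
have [hD _ _] := Hp i; have := hD t; rewrite /disp fl_U => h.
have [b1 b2] := fl_bounds i (V t); have [b3 b4] := fl_bounds i t.
split=> [e|[q /andP[h1 h2]]].
  by exists (fl i t); apply/andP; split=> //; have -> : fl i t = fl i (V t) + 1 by lia.
have : q <= fl i t by rewrite fl_ge.
have : fl i (V t) < q by rewrite ltNge fl_ge; lia.
lia.
Qed.

Definition plus t := (t < V t) && (V t < t + n).
Definition minus t := (t - n < V t) && (V t < t).

Lemma trichotomy t : [\/ plus t, minus t | eqm (V t) t].
Proof.
have h1 := V_le t; have h2 := V_ge t; rewrite /plus /minus.
case: (eqVneq (V t) (t - n)) => [->|h3].
  by apply: Or33; apply/eqmP; exists (-1); lia.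
case: (eqVneq (V t) t) => [->|h4]; first by apply: Or33; apply: eqmxx.
case: (eqVneq (V t) (t + n)) => [->|h5].
  by apply: Or33; apply/eqmP; exists 1; lia.
case: (ltP t (V t)) => h; [apply: Or31 | apply: Or32]; lia.
Qed.

Lemma plus_move t : plus t -> eqm (V t) t = false.
Proof. by move=> /andP[h1 h2]; rewrite eqmC eqm_near. Qed.

Lemma plus_minus t : plus t -> minus t = false.
Proof. by rewrite /plus /minus; lia. Qed.

Lemma plus_star t : plus (-1 - t) = minus t.
Proof. by rewrite /plus /minus V_star; apply/andP/andP; lia. Qed.

Lemma minus_star t : minus (-1 - t) = plus t.
Proof. by rewrite /plus /minus V_star; apply/andP/andP; lia. Qed.

Lemma mul_n_le1 k : k * n <= n -> k <= 1.
Proof. have := n_gt0; nia. Qed.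

Lemma mul_n_gt0 k : 0 < k * n -> 0 < k.
Proof. have := n_gt0; nia. Qed.

Lemma N_mono i i' : (forall t, disp w i t = 0 -> disp w i' t = 0) -> N i <= N i'.
Proof.
move=> h; apply: rsum_le => t.
by case: (eqVneq (disp w i t) 0) => [/h ->|].
Qed.

Lemma N_strict i i' t : (forall t, disp w i t = 0 -> disp w i' t = 0) ->
  disp w i' t = 0 -> disp w i t <> 0 -> N i < N i'.
Proof.
move=> h h1 h2; apply: (rsum_lt (t := t)) (zeros_per w i) (zeros_per w i') _ _.
  by move=> u; case: (eqVneq (disp w i u) 0) => [/h ->|].
by rewrite h1 eqxx; case: eqP.
Qed.

Lemma ascent_exists a b : a < b -> ~~ eqm a b -> V a < V b -> V b <= a + n -> b <= V a + n ->
  (forall i, N i + Posz (raises a b i) +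
     (if eqm (-1 - a) b then 0 else Posz (raises a b (- i))) <= Posz s) ->
  exists y, step w y /\ forall i, perm_at s y i.
Proof.
move=> hab ne hV hb1 hb2 hN.
have hW := level2_inW Hw; have [r [hr hrE]] := exists_R ne.
have yE t : U (ewmul r w) t = U w (R a b t) by rewrite U_mul hrE.
exists (ewmul r w); split; last exact: ascent hab ne hV hb1 hb2 yE hN.
by split=> //; exists a, b; split=> //; move: hV; rewrite /V; lia.
Qed.

(* If no two intervals [(a, V a]] and [(b, V b]] cross, then the end of each interval [(t, V t]] is
   also the end of an interval [(V u, u]], and similarly for the starting points. *)
Section NonCrossing.
Hypothesis NX : forall a b, a < b -> b <= V a -> V a < V b -> V b <= a + n -> False.

Lemma NX_dual a b : V a < V b -> V b <= a -> a < b -> b <= V a + n -> False.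
Proof. by move=> h1 h2 h3 h4; apply: (NX (a := -1 - b) (b := -1 - a)); rewrite ?V_star; lia. Qed.

Lemma plus_to_minus t : plus t -> minus (V t).
Proof.
move=> hp; have /andP[h1 h2] := hp.
case: (trichotomy (V t)) => // [hb|]; last by rewrite V_eqm plus_move.
have /andP[h3 h4] := hb; exfalso.
(* If [V t] moved up too, then either [t] and [V t] would cross, or [V t] and [t + n] would. *)
case: (leP (V (V t)) (t + n)) => h5; first exact: (NX h1 (lexx _) h3 h5).
have e : V (t + n) = V t + n by have := V_per t 1; rewrite !mul1r.
by apply: (NX (a := V t) (b := t + n)); rewrite ?e; lia.
Qed.

Lemma preim_minus i t : plus i -> V t = i -> minus t.
Proof.
move=> hi e; case: (trichotomy t) => // [/plus_to_minus|h].
  by rewrite e => h; move: (plus_minus hi); rewrite h.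
have := plus_move hi; rewrite -e V_eqm => h'.
by move: h; rewrite h'.
Qed.

(** No interval [(V t, t]] ends at [i], while the one with [V t0 = i] begins there. *)
Lemma N_plus i : plus i -> N i < N (i + 1).
Proof.
move=> hi; have /andP[h1 h2] := hi; have [t0 e0] := V_surj i.
have /andP[h3 h4] := preim_minus hi e0; apply: (@N_strict _ _ t0).
- move=> t /coverP[q /andP[h5 h6]]; apply/coverP; exists q.
  case: (leP (i + 1 + q * n) t) => h7; first by lia.
  have e : t = i + q * n by lia.
  by move: h5; rewrite e V_per; lia.
- by apply/coverP; exists 0; lia.
move=> /coverP[q /andP[h5 h6]].
have : eqm i (i + q * n) = false by apply: eqm_near; lia.
by rewrite eqmC eqm_shift.
Qed.

(** The intervals [(V t, t]] that begin or end at [i] modulo [n] have [t] congruent to [i] and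
    length [n], so they cover [i] and [i + 1] alike. *)
Lemma N_fixed i : eqm (V i) i -> N (i + 1) = N i.
Proof.
move=> hi; have [k hk] := eqmP _ _ hi.
have dE t q : t = i + q * n -> V t < t -> V t = t - n.
  move=> e h; have h1 := V_ge t; rewrite e V_per hk in h h1 *.
  have := @mul_n_le1 (- k) ltac:(lia); have := @mul_n_gt0 (- k) ltac:(lia) => h2 h3.
  have ek : k = -1 by lia.
  by rewrite ek; lia.
apply/eqP; rewrite eq_le; apply/andP; split; apply: N_mono => t /coverP[q /andP[h1 h2]].
  case: (ltP (V t) (i + q * n)) => h3; first by apply/coverP; exists q; lia.
  have e : V t = i + q * n by lia.
  have : eqm t i by rewrite -V_eqm e (eqm_l _ (eqm_shift i q)) eqmC.
  move=> /eqmP[q' e']; have := dE _ _ e' ltac:(lia) => e2.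
  apply/coverP; exists q'; lia.
case: (leP (i + 1 + q * n) t) => h3; first by apply/coverP; exists q; lia.
have e : t = i + q * n by lia.
have := dE _ _ e ltac:(lia) => e2.
apply/coverP; exists (q - 1); lia.
Qed.

(** An interval that contains [x] but no translate of [V x + 1] would begin inside [(V x, x]] and
    cross it. *)
Lemma N_minus_chord (x : int) : minus x -> N x <= N (V x + 1).
Proof.
move=> /andP[h1 h2]; apply: N_mono => t /coverP[q /andP[h3 h4]].
have e : V (t + (- q) * n) = V t - q * n by rewrite V_per; lia.
case: (leP (V t - q * n) (V x)) => h5; first by apply/coverP; exists q; lia.
case: (leP (t - q * n) (V x + n)) => h6; last by apply/coverP; exists (q + 1); lia.
exfalso; apply: (NX_dual (a := x) (b := t + (- q) * n)); rewrite ?e; try lia.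
case: (eqVneq x (t + (- q) * n)) => e'; last by lia.
by move: h5; rewrite -e -e'; lia.
Qed.

Lemma N_plus_chord (y : int) : plus y -> N (y + 1) <= N (V y).
Proof.
rewrite -minus_star => /N_minus_chord; rewrite V_star.
have -> : -1 - y = - (y + 1) by lia.
have -> : -1 - V y + 1 = - V y by lia.
by rewrite !N_opp.
Qed.

(* With [h = N (y + 1)], the interval [(x, y]] is a maximal one on which [N < h]; it is therefore
   equal to its mirror image or disjoint from it (mod [n]), so exchanging [x] and [y] raises [N]
   by at most one and only where [N < h <= s]. *)
Lemma ascent_plus (y : int) : plus y -> exists z, step w z /\ forall i, perm_at s z i.
Proof.
move=> hy; have /andP[h1 h2] := hy; set h := N (y + 1).
pose P (k : nat) := h <= N (y - 1 - Posz k).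
(* The search for [x] downwards from [y - 1] stops at [V y - n] at the latest, which also yields
   [V y <= x + n]. *)
have hP : P (absz (y - 1 - V y + n)%R).
  rewrite /P; have -> : y - 1 - Posz (absz (y - 1 - V y + n)%R) = V y + (-1) * n by lia.
  by rewrite N_per; apply: N_plus_chord.
have exP : exists k, P k by exists (absz (y - 1 - V y + n)%R).
case: (ex_minnP exP) => k hk kmin; have k0 := kmin _ hP.
set x := y - 1 - Posz k.
have hx : h <= N x by [].
have low i : x < i -> i <= y -> N i < h.
  move=> hi1 hi2; case: (eqVneq i y) => [->|ne]; first exact: N_plus.
  rewrite ltNge; apply/negP => hi; have := kmin (absz (y - 1 - i)%R).
  rewrite /P; have -> : y - 1 - Posz (absz (y - 1 - i)%R) = i by lia.
  by move=> /(_ hi); lia.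
have xy : x < y by lia.
have hmx : minus x.
  case: (trichotomy x) => // [/N_plus|/N_fixed] hx1; have := low (x + 1); lia.
have /andP[h3 h4] := hmx.
(* Otherwise [V x + 1 + n] would lie in [(x, y]], although [N] is at least [N x] there. *)
have hyx : y <= V x + n.
  rewrite leNgt; apply/negP => hlt; have := N_minus_chord hmx.
  by rewrite -(N_per (V x + 1) 1); have := low (V x + 1 + 1 * n) ltac:(lia) ltac:(lia); lia.
have ne : ~~ eqm x y.
  apply/negP => /eqmP[q e]; move: h4; rewrite e V_per; lia.
have region i : raises x y i -> exists q, x < i + q * n <= y.
  move=> /and3P[_ hlt _]; exists (fl i y); rewrite -fl_ge lexx andbT ltNge -fl_ge; lia.
have hr i : raises x y i -> N i < h.
  by move=> /region[q /andP[r1 r2]]; rewrite -(N_per i q); apply: low.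
apply: (ascent_exists xy ne) => //; [lia | lia | move=> i].
have hs : h <= Posz s := N_le _.
case: ifP => [_|hsd].
  by case e : (raises x y i) => /=; [have := hr _ e | have := N_le i]; lia.
case e1 : (raises x y i); case e2 : (raises x y (- i)) => /=.
- have [q1 /andP[r1 r2]] := region _ e1; have [q2 /andP[r3 r4]] := region _ e2.
  (* If [i] and [-i] both have translates in [(x, y]], this interval meets its mirror image shifted
     by [K * n]. Since [N] is at least [h] at [K * n - x] and [K * n - (y + 1)], both lie outside
     [(x, y]], and the two intervals coincide. *)
  set K := q1 + q2.
  have n1 : N (- x + K * n) = N x by rewrite N_per N_opp.
  have n2 : N (- (y + 1) + K * n) = h by rewrite N_per N_opp.
  have c1 : y < K * n - x.
    rewrite ltNge; apply/negP => hle; have := low (- x + K * n); lia.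
  have c2 : K * n - x <= y + 1.
    rewrite leNgt; apply/negP => hlt; have := low (- (y + 1) + K * n); lia.
  have : eqm (-1 - x) y by apply/eqmP; exists (- K); lia.
  by rewrite hsd.
- by have := hr _ e1; lia.
- by have := hr _ e2; rewrite N_opp; lia.
by have := N_le i; lia.
Qed.

End NonCrossing.

(** The interval on which [N] could rise is contained in [(V a, b]], which is empty. *)
Lemma ascent_crossing a b : a < b -> b <= V a -> V a < V b -> V b <= a + n ->
  exists z, step w z /\ forall i, perm_at s z i.
Proof.
move=> h1 h2 h3 h4.
have ne : ~~ eqm a b by rewrite eqm_near //; lia.
apply: (ascent_exists h1 ne h3 h4); first by lia.
have r0 i : raises a b i = false.
  apply/negP => /and3P[/eqP e1 e2 _]; have := fl_mono i h2; lia.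
by move=> i; rewrite !r0 /=; case: ifP => _; have := N_le i; lia.
Qed.

(** Now [N] is constant. If no entry were 1, half of them would be 0 and [N 0] would be [m], against
    [N 0 < s <= m]. So there is a fixed point of [V]; exchanging it with its mirror image raises [N]
    by at most one. *)
Lemma ascent_fixed : (forall t, eqm (V t) t) -> N 0 < Posz s ->
  exists z, step w z /\ forall i, perm_at s z i.
Proof.
move=> hf hN.
have DE i t : disp w i t = disp w 0 t.
  by have [q e] := eqmP _ _ (hf t); rewrite /disp !fl_U e !fl_per; lia.
have NE i : N i = N 0 by apply: eq_bigr => j _; rewrite DE.
have [t ht] : exists t : I2, disp w 0 (Posz (nat_of_ord t)) = 1.
  apply: NNPP => hn.
  have : rsum (fun t => Posz (disp w 0 t == 0) + Posz (disp w 0 t == 2)) = rsum (fun _ => 1).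
    apply: eq_bigr => j _; have [h _ _] := Hp 0; have := h (Posz (nat_of_ord j)).
    case: (eqVneq (disp w 0 (Posz (nat_of_ord j))) 1) => [e|ne]; last by lia.
    by case: hn; exists j.
  rewrite rsum_const rsum_add (twos_zeros (Hp 0)) -/(N 0) -[rsum _]/(N 0).
  by move: hN Hs; lia.
have vt : V (Posz (nat_of_ord t)) = Posz (nat_of_ord t).
  have [q e] := eqmP _ _ (hf (Posz (nat_of_ord t))).
  move: ht; rewrite /disp fl_U e fl_per => hq.
  have eq0 : q = 0 by lia.
  by rewrite eq0; lia.
have tn := ltn_ord t; set c := Posz (nat_of_ord t) in vt.
have vt' : V (-1 - c + 1 * n) = -1 - c + 1 * n by rewrite V_per V_star vt.
have key a b : a + b = n - 1 -> 0 <= a -> a < b -> V a = a -> V b = b ->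
    exists z, step w z /\ forall i, perm_at s z i.
  move=> e ha hab va vb.
  have ne : ~~ eqm a b by rewrite eqm_near //; lia.
  apply: (ascent_exists hab ne); rewrite ?va ?vb //; [lia | lia | move=> i].
  have -> : eqm (-1 - a) b by apply/eqmP; exists (-1); lia.
  by rewrite NE; case: (raises _ _ _); lia.
case: (ltP c (-1 - c + 1 * n)) => hc.
  by apply: (key c (-1 - c + 1 * n) _ _ hc vt vt'); rewrite /c; lia.
by apply: (key (-1 - c + 1 * n) c _ _ _ vt' vt); rewrite /c in hc *; lia.
Qed.

Lemma ascent_dichotomy : ((forall t, eqm (V t) t) /\ N 0 = Posz s) \/
  exists z, step w z /\ forall i, perm_at s z i.
Proof.
case: (classic (exists a b, [/\ a < b, b <= V a, V a < V b & V b <= a + n])) => [|nx].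
  by move=> [a [b [h1 h2 h3 h4]]]; right; apply: ascent_crossing h1 h2 h3 h4.
have NX a b : a < b -> b <= V a -> V a < V b -> V b <= a + n -> False.
  by move=> *; apply: nx; exists a, b.
case: (classic (exists t, plus t)) => [[t ht]|np]; first by right; apply: (ascent_plus NX ht).
have hf t : eqm (V t) t.
  case: (trichotomy t) => // h; case: np; first by exists t.
  by exists (-1 - t); rewrite plus_star.
have := N_le 0; rewrite le_eqVlt => /orP[/eqP e|h]; first by left.
by right; apply: ascent_fixed.
Qed.

End Ascent.

(** * Reaching a translation *)

Lemma energy_le s w : (s <= m)%N -> (forall i, perm_at s w i) -> energy w <= (2 * n) ^+ 2 * n.
Proof.
move=> hs hp; rewrite -rsum_const; apply: rsum_le => t.
have := V_le hs hp t; have := V_ge hs hp t; rewrite /V => h1 h2.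
by rewrite ler_sqr ?nnegrE; lia.
Qed.

(** The energy increases at each ascent and is bounded on permissible elements. *)
Lemma climb s w : (s <= m)%N -> level2 w -> (forall i, perm_at s w i) ->
  exists z, [/\ steps w z, level2 z, forall i, perm_at s z i,
    forall t, eqm (V z t) t & zeros z 0 = Posz s].
Proof.
move=> hs; have [M] := ubnP (absz ((2 * n) ^+ 2 * n - energy w)%R).
elim: M w => // M IH w hM hl hp.
case: (ascent_dichotomy hs hl hp) => [[h1 h2]|[y [st hy]]].
  by exists w; split=> //; apply: rt_refl.
have hq := energy_step st; have hqy := energy_le hs hy.
have hly : level2 y := perm_at_level2 (step_inW st) (hy 0).
have [|z [h1 h2 h3 h4 h5]] := IH y _ hly hy; first by lia.
by exists z; split=> //; apply: rt_trans h1; apply: rt_step.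
Qed.

(** Induction on the number of zeros of [lam] that are not zeros of [nu]: each is exchanged with a
    surplus zero of [nu], together with the mirror images. Once the zeros agree, duality makes the
    twos agree. *)
Lemma star_conjugate (lam nu : I2 -> int) :
  (forall j, 0 <= lam j <= 2) -> (forall j, 0 <= nu j <= 2) ->
  (forall j, lam j + lam (star j) = 2) -> (forall j, nu j + nu (star j) = 2) ->
  #|[set j | lam j == 0]| = #|[set j | nu j == 0]| ->
  exists sg : {perm I2}, inSstar sg /\ forall j, permvec sg nu j = lam j.
Proof.
have [M] := ubnP #|[set j | (lam j == 0) && (nu j != 0)]|.
elim: M nu => // M IH nu hM bl bn sl sn hc.
case: (set_0Vmem [set j | (lam j == 0) && (nu j != 0)]) => [e0|[j]].
  have sub : [set j | lam j == 0] \subset [set j | nu j == 0].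
    apply/subsetP => j; rewrite !inE => hj; apply/negPn/negP => hn.
    by have := in_set0 j; rewrite -e0 inE hj hn.
  have eqS : [set j | lam j == 0] = [set j | nu j == 0].
    by apply/eqP; rewrite eqEcard sub hc leqnn.
  have eq0 j : (lam j == 0) = (nu j == 0) by have /setP/(_ j) := eqS; rewrite !inE.
  exists 1%g; split=> [j|j]; first by rewrite !perm1.
  rewrite /permvec invg1 perm1.
  have := eq0 j; have := eq0 (star j); have := bl j; have := bn j; have := sl j; have := sn j.
  lia.
rewrite inE => /andP[/eqP lj nj].
have [k /andP[/eqP nk lk]] : exists k, (nu k == 0) && (lam k != 0).
  apply/existsP; apply: contraNT nj; rewrite negb_exists => /forallP hall.
  have sub : [set j | nu j == 0] \subset [set j | lam j == 0].
    by apply/subsetP => l; rewrite !inE => hl; have := hall l; rewrite hl /= negbK.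
  have /setP/(_ j) : [set j | nu j == 0] = [set j | lam j == 0].
    by apply/eqP; rewrite eqEcard sub hc leqnn.
  by rewrite !inE lj eqxx => ->.
have jk : j != k by apply: contraNneq lk => <-; rewrite lj.
have ne : ~~ eqm (Posz (nat_of_ord j)) (Posz (nat_of_ord k)) by rewrite eqm_ord.
have [r [[_ hr] hrE]] := exists_R ne.
pose p l := (r.2)^-1%g l.
have pE l : p l = res (R (Posz (nat_of_ord j)) (Posz (nat_of_ord k)) (Posz (nat_of_ord l))).
  by rewrite -hrE res_U res_ord.
have pj : p j = k by rewrite pE R_l0 res_ord.
have pk : p k = j by rewrite pE R_r0 // res_ord.
have ps l : p (star l) = star (p l).
  by apply: (@perm_inj _ r.2); rewrite /p permKV hr permKV.
have pout l : l != j -> l != k -> l != star j -> l != star k -> p l = l.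
  by move=> *; rewrite pE R_out ?eqm_ord ?eqm_ord_star // res_ord.
have [||||sg [h1 h2]] := IH (fun l => nu (p l)) _ bl _ sl _ _.
- apply: leq_trans (_ : _ < _)%N _; last exact: hM.
  apply: proper_card; apply/properP; split; last first.
    by exists j; rewrite !inE lj eqxx ?nj // pj nk eqxx.
  apply/subsetP => l; rewrite !inE => /andP[/eqP hl hn]; rewrite hl eqxx /=.
  case: (eqVneq l j) hl hn => [->|n1] hl hn //.
  case: (eqVneq l k) hl hn => [->|n2] hl hn; first by rewrite hl in lk.
  case: (eqVneq l (star j)) hl hn => [->|n3] hl hn; first by have := sl j; lia.
  case: (eqVneq l (star k)) hl hn => [->|n4] hl hn; first by have := sn k; lia.
  by move: hn; rewrite pout.
- by move=> l.
- by move=> l; rewrite ps.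
- rewrite hc -(card_imset _ (@perm_inj _ r.2)); congr #|pred_of_set _|.
  apply/setP => l; rewrite !inE; apply/imsetP/idP => [[l' hl' ->]|hl].
    by move: hl'; rewrite inE /p permK.
  by exists (p l); rewrite ?inE // /p permKV.
exists (r.2 * sg)%g; split=> l; first by rewrite !permM hr h1.
by rewrite -h2 /permvec invMg permM.
Qed.

Lemma mu_star s (j : I2) : (s <= m)%N -> mu s j + mu s (star j) = 2.
Proof.
move=> hs; have := star_val j; have := ltn_ord j; rewrite /mu /=.
set x := nat_of_ord (star j); set y := nat_of_ord j => h1 h2.
by do !case: ifP; lia.
Qed.

Lemma mu_card s : (s <= m)%N -> #|[set j : I2 | mu s j == 0]| = s.
Proof.
move=> hs; apply/eqP; rewrite -eqz_nat card_sum.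
rewrite (eq_bigr (fun j : I2 => if (j < s)%N then 0 else if (j < m.*2 - s)%N then 0 else 1)).
  by rewrite sum_three //; apply/eqP; lia.
by move=> j _; rewrite /mu; case: ifP => // _; case: ifP.
Qed.

Lemma steps_translation s w : (s <= m)%N -> level2 w -> (forall i, perm_at s w i) ->
  exists sg : {perm I2}, inSstar sg /\ steps w (trans (permvec sg (mu s))).
Proof.
move=> hs hl hp; have [z [h1 h2 h3 h4 h5]] := climb hs hl hp.
have z2 j : (z.2)^-1%g j = j.
  rewrite -(res_ord j) -res_U; apply/eqP; rewrite res_eqm.
  have := h4 (Posz (nat_of_ord j)); rewrite /V => /eqmP[q e].
  by apply/eqmP; exists (q + 1); lia.
have zD (j : I2) : disp z 0 (Posz (nat_of_ord j)) = z.1 j.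
  by rewrite /disp U_ord z2 fl_per; lia.
have [hb _ _] := h3 0.
have [j|j|j|j||sg [hsg e]] := @star_conjugate (fun j => z.1 j) (mu s).
- by rewrite -zD.
- by rewrite /mu; case: ifP => // _; case: ifP.
- have := disp_star 0 (Posz (nat_of_ord j)) h2; rewrite zD.
  have -> : -1 - Posz (nat_of_ord j) = Posz (nat_of_ord (star j)) + (-1) * n.
    by rewrite star_val; lia.
  by rewrite disp_per oppr0 zD; lia.
- exact: mu_star.
- apply/eqP; rewrite mu_card // -eqz_nat card_sum -h5.
  by apply/eqP/eq_bigr => j _; rewrite zD.
exists sg; split=> //.
have -> : trans (permvec sg (mu s)) = z; last by [].
apply: U_ext => t; rewrite U_trans UE z2 e [in LHS](ord_decomp t).
by rewrite (_ : res _ = res t); [lia | rewrite -ord_decomp].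
Qed.

(** * Lifting permissibility from a parahoric to the Iwahori level *)

Lemma fl_anti i i' t : i <= i' -> fl i' t <= fl i t.
Proof. by move=> h; rewrite fl_ge; have := fl_bounds i' t; lia. Qed.

Lemma rsum_neg_pos (g : int -> int) t : periodic g -> rsum g = 0 -> g t < 0 -> exists k, 0 < g k.
Proof.
move=> hg h0 ht; apply: NNPP => hn.
have : rsum g < rsum (fun _ => 0).
  apply: (rsum_lt (t := t)) => // k; rewrite leNgt; apply/negP => hk.
  by apply: hn; exists k.
by rewrite h0 rsum_const mul0r ltxx.
Qed.

Section Lift.
Variables (s : nat) (I : {set 'I_m.+1}) (i0 : int).
Hypothesis I0 : I != set0.
Hypothesis i0_range : 0 <= i0 <= Posz m.
Hypothesis i0J : ~ inI2m I i0.
Local Notation J i := (inI2m I i).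
Local Notation d w := (disp w i0).

Definition spread w : int := rsum (fun t => (d w t - 1) ^+ 2).

Lemma spread_ge0 w : 0 <= spread w.
Proof. by apply: sumr_ge0 => j _; rewrite sqr_ge0. Qed.

(* The value exchanges whose effect at [i0] does not interfere with their mirror image. *)
Definition balanced w := forall j k, Jeq I (U w j) (U w k) ->
  fl i0 (U w k) < fl i0 (U w j) ->
  eqm (-1 - j) k \/ fl (- i0) (U w k) = fl (- i0) (U w j) -> d w j - d w k <= 1.

(** A gap of [J] has length at most [n], so it holds at most one translate of [i]. *)
Lemma Jeq_fl i a b : Jeq I a b -> a < b -> fl i b <= fl i a + 1.
Proof.
have [i1 hi1] := J_ex I0; move=> /(_ _ hi1) e hab.
have [h1 h2] := fl_bounds i1 a; have [h3 h4] := fl_bounds i1 b.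
rewrite -fl_per; apply: fl_mono; rewrite e in h1; lia.
Qed.

(** The exchange lowers [d w j] and raises [d w k] by one, changing the spread by
    [2 - 2 * (d w j - d w k)]. The disjunction ensures that the mirror pair adds nothing. *)
Lemma spread_swap w j k : level2 w -> Jeq I (U w j) (U w k) ->
  fl i0 (U w k) < fl i0 (U w j) ->
  eqm (-1 - j) k \/ fl (- i0) (U w k) = fl (- i0) (U w j) -> 1 < d w j - d w k ->
  exists z, inWI I z /\ spread (ewmul w z) < spread w.
Proof.
move=> hl hJ hlt hor hd.
have hW := level2_inW hl.
have hlt' : U w k < U w j := fl_lt hlt.
have ne : ~~ eqm j k.
  apply/negP => /eqmP[q e]; have [i hi] := J_ex I0; have := hJ i hi.
  by rewrite e U_per fl_per => hq; move: hlt'; rewrite e U_per; nia.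
have ne' : ~~ eqm (U w j) (U w k) by rewrite U_eqm.
have [z [hz hzE]] := exists_R ne'.
exists z; split; first exact: R_inWI hJ hz hzE.
have yE t : U (ewmul w z) t = U w (R j k t) by rewrite U_mul hzE R_conj.
set y := ewmul w z in yE *.
have [e1 e2 e3 e4] := R_image ne yE.
have hle : fl i0 (U w j) <= fl i0 (U w k) + 1.
  by apply: Jeq_fl => // i hi; rewrite hJ.
have d1 : d y j = d w j - 1 by rewrite /disp e1; lia.
have d2 : d y k = d w k + 1 by rewrite /disp e2; lia.
rewrite -subr_lt0 /spread -rsum_sub (rsum_supp _ ne); last first.
- by move=> t ht; rewrite /disp yE ht subrr.
- by move=> t q; rewrite !disp_per.
have main : (d y j - 1) ^+ 2 - (d w j - 1) ^+ 2 + ((d y k - 1) ^+ 2 - (d w k - 1) ^+ 2) < 0.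
  rewrite d1 d2.
  have -> : (d w j - 1 - 1) ^+ 2 - (d w j - 1) ^+ 2 + ((d w k + 1 - 1) ^+ 2 - (d w k - 1) ^+ 2)
     = 2 - 2 * (d w j - d w k) by ring.
  lia.
case: ifP => [_|hsd]; first by rewrite addr0.
case: hor => [h|h]; first by rewrite h in hsd.
have d3 : d y (-1 - j) = d w (-1 - j).
  by rewrite /disp e3 !hl !fl_per !fl_starr h.
have d4 : d y (-1 - k) = d w (-1 - k).
  by rewrite /disp e4 !hl !fl_per !fl_starr h.
by rewrite d3 d4 !subrr !addr0.
Qed.

Lemma exists_balanced w : inW w -> (forall i, J i -> perm_at s w i) ->
  exists z, [/\ inWI I z, level2 (ewmul w z), balanced (ewmul w z) &
                forall i, J i -> perm_at s (ewmul w z) i].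
Proof.
have [M] := ubnP (absz (spread w)); elim: M w => // M IH w hM hW hp.
have [i1 hi1] := J_ex I0.
have hl := perm_at_level2 hW (hp i1 hi1).
case: (classic (balanced w)) => [hb|].
  by exists (ew1 m); rewrite ewmul1; split=> //; exact: inWI1.
move=> hb; have [z [hz hlt]] : exists z, inWI I z /\ spread (ewmul w z) < spread w.
  apply: NNPP => hn; apply: hb => j k h1 h2 h3; rewrite leNgt; apply/negP => h4.
  exact/hn/(spread_swap hl h1 h2 h3 h4).
have hWz : inW (ewmul w z) by apply: inW_mul => //; case: hz.
have hc : incoset I w (ewmul w z) by exists z.
have [||z' [h1 h2 h3 h4]] := IH (ewmul w z) _ hWz.
- by have := spread_ge0 (ewmul w z); lia.
- by move=> i hi; apply: perm_at_coset hc hi (hp i hi).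
exists (ewmul z z'); rewrite ewmulA; split=> //; exact: inWI_mul.
Qed.

Section Balanced.
Variable w : ew m.
Hypothesis Hl : level2 w.
Hypothesis Hb : balanced w.
Hypothesis Hp : forall i, J i -> perm_at s w i.

(* When both [i0] and [-i0] separate [U w k] from [U w j], these values lie in a self-dual gap
   of [J], and the bound follows from the exchanges of [j] and of [k] with their mirror images. *)
Lemma balanced_all j k : Jeq I (U w j) (U w k) -> fl i0 (U w k) < fl i0 (U w j) ->
  d w j - d w k <= 1.
Proof.
move=> hJ hlt; have hkj := fl_lt hlt.
have hJ' : Jeq I (U w k) (U w j) by move=> i hi; rewrite hJ.
case: (eqVneq (fl (- i0) (U w k)) (fl (- i0) (U w j))) => [e|ne].
  by apply: Hb => //; right.
have g1 := Jeq_fl i0 hJ' hkj; have g2 := Jeq_fl (- i0) hJ' hkj.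
have g3 := fl_mono (- i0) (ltW hkj).
set q2 := fl i0 (U w j) in hlt g1; set q1 := fl (- i0) (U w j) in ne g2 g3.
have a1 : U w k < i0 + q2 * n by rewrite ltNge -fl_ge; lia.
have a2 : i0 + q2 * n <= U w j by rewrite -fl_ge.
have a3 : U w k < - i0 + q1 * n by rewrite ltNge -fl_ge; lia.
have a4 : - i0 + q1 * n <= U w j by rewrite -fl_ge.
(* This shift places the values of [U w] at the mirror images of [j] and [k] in the same gap of [J]
   as [U w j] and [U w k]. *)
pose K := q1 + q2 - 2.
pose k' := -1 - k + K * n; pose j' := -1 - j + K * n.
have uk : U w k' = -1 - U w k + (q1 + q2) * n by rewrite U_per Hl /K; lia.
have uj : U w j' = -1 - U w j + (q1 + q2) * n by rewrite U_per Hl /K; lia.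
have eq' i : J i -> fl i (U w k') = fl i (U w j').
  by move=> hi; rewrite uk uj !fl_per !fl_starr hJ //; apply: J_opp.
have Jk : Jeq I (U w k') (U w k).
  move=> i hi; have h1 := eq' i hi; have h2 := hJ i hi.
  have := @fl_mono i (U w k) (U w k') ltac:(lia).
  have := @fl_mono i (U w j') (U w j) ltac:(lia); lia.
have Jj : Jeq I (U w j) (U w j').
  move=> i hi; have h1 := eq' i hi; have h2 := hJ i hi.
  have := @fl_mono i (U w k) (U w k') ltac:(lia).
  have := @fl_mono i (U w j') (U w j) ltac:(lia); lia.
have b1 : d w k' - d w k <= 1.
  apply: Hb => //.
    by have := fl_ge i0 (U w k') q2; lia.
  by left; rewrite eqm_starl eqm_shift.
have b2 : d w j - d w j' <= 1.
  apply: Hb => //.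
    by have := fl_ge i0 (U w j') q2; lia.
  by left; rewrite eqmC eqm_shift.
have gb t : 0 <= fl (- i0) t - fl i0 t <= 1.
  have h1 := @fl_anti (- i0) i0 t ltac:(lia).
  have h2 := @fl_anti i0 (- i0 + 1 * n) t ltac:(lia).
  by move: h2; rewrite fl_peri; lia.
have dd t q : d w (-1 - t + q * n) = 2 - (fl (- i0) (U w t) - fl (- i0) t).
  by rewrite disp_per -{1}(opprK i0) disp_star.
rewrite /k' dd in b1; rewrite /j' dd in b2.
(* Chaining [b1] and [b2] through [gb] gives [2 * fl i0 k <= 2 * fl i0 j + 1], hence
   [fl i0 k <= fl i0 j]. *)
have := gb j; have := gb k; move: b1 b2; rewrite /disp -/q1 -/q2; lia.
Qed.

Lemma inI2m_dec i : {b : bool | b <-> J i}.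
Proof.
exists [exists a : 'I_m.+1, (a \in I) &&
  (eqm i (Posz (nat_of_ord a)) || eqm i (- Posz (nat_of_ord a)))].
split.
  move=> /existsP[a /andP[ha h]]; apply/inI2mP; exists a => //.
  by case/orP: h => /eqmP[q e]; exists q; [left|right].
move=> /inI2mP[a ha [q h]]; apply/existsP; exists a; rewrite ha /=.
by case: h => ->; rewrite eqm_shift ?orbT.
Qed.

Lemma J_next i : exists2 k : nat, J (i + Posz k) & forall k' : nat, J (i + Posz k') -> (k <= k')%N.
Proof.
pose P (k : nat) := sval (inI2m_dec (i + Posz k)).
have PE k : P k <-> J (i + Posz k) by rewrite /P; case: (inI2m_dec _).
have [i1 hi1] := J_ex I0.
have exP : exists k, P k.
  exists (absz (i1 + (- fl i i1) * n - i)%R); apply/PE.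
  have [h1 h2] := fl_bounds i i1.
  have -> : i + Posz (absz (i1 + (- fl i i1) * n - i)%R) = i1 + (- fl i i1) * n by lia.
  exact: J_per.
case: (ex_minnP exP) => k /PE hk kmin; exists k => // k' /PE; exact: kmin.
Qed.

Lemma J_gap : exists a a', [/\ J a, J a', a < i0 < a', a' <= a + n &
  forall i, J i -> a < i -> a' <= i].
Proof.
(* The element of [J] preceding [i0] is the opposite of the one following [-i0]. *)
have [k hk kmin] := J_next i0; have [k' hk' kmin'] := J_next (- i0).
exists (i0 - Posz k'), (i0 + Posz k).
have ha : J (i0 - Posz k').
  by have := J_opp hk'; congr (inI2m _ _); lia.
have k0 : k <> 0%N by move=> e; apply: i0J; rewrite e addr0 in hk.
have k0' : k' <> 0%N by move=> e; apply: i0J; move: ha; rewrite e subr0.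
have next i : J i -> i0 - Posz k' < i -> i0 + Posz k <= i.
  move=> hi hlt; case: (leP i0 i) => h.
    have := kmin (absz (i - i0)%R); have -> : i0 + Posz (absz (i - i0)%R) = i by lia.
    by move=> /(_ hi); lia.
  have := kmin' (absz (i0 - i)%R); have -> : - i0 + Posz (absz (i0 - i)%R) = - i by lia.
  by move=> /(_ (J_opp hi)); lia.
split=> //; first by lia.
have h1 := J_per 1 ha; rewrite mul1r in h1; apply: next => //.
have := n_gt0; lia.
Qed.

(** The entries at [i0] are compared with those at its neighbours [a] and [a'] in [J]. They differ
    through [pa] and [pb], the indicators of [[a, i0)] and [[i0, a')] modulo [n], whose total
    variation along [U w] is zero. *)
Lemma balanced_perm_at : perm_at s w i0.
Proof.
have [a [a' [ha ha' /andP[aa0 a0a'] aa' gap]]] := J_gap.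
pose pa t := fl a t - fl i0 t; pose pb t := fl i0 t - fl a' t.
have pab t : [/\ 0 <= pa t, 0 <= pb t & pa t + pb t <= 1].
  have h1 := fl_anti t (ltW aa0); have h2 := fl_anti t (ltW a0a').
  have h3 := @fl_anti a' (a + 1 * n) t ltac:(lia).
  by move: h3; rewrite /pa /pb fl_peri; split; lia.
have pap : periodic pa by move=> t q; rewrite /pa !fl_per; lia.
have pbp : periodic pb by move=> t q; rewrite /pb !fl_per; lia.
have dA t : disp w a t = d w t + pa (U w t) - pa t by rewrite /disp /pa; lia.
have dB t : disp w a' t = d w t - pb (U w t) + pb t by rewrite /disp /pb; lia.
have Upb (p : int -> int) : periodic p -> periodic (fun t => p (U w t) - p t).
  by move=> hp t q; rewrite U_per !hp.
have US (p : int -> int) : periodic p -> rsum (fun t => p (U w t) - p t) = 0.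
  by move=> hp; rewrite rsum_sub rsum_reindex // subrr.
have [A1 A2 A3] := Hp ha; have [B1 B2 B3] := Hp ha'.
have sep j k : pa (U w k) = 1 -> pb (U w j) = 1 -> d w j - d w k <= 1.
  move=> hk hj.
  pose k1 := k + (- fl a (U w k)) * n; pose j1 := j + (- fl i0 (U w j)) * n.
  have uk : U w k1 = U w k + (- fl a (U w k)) * n by rewrite U_per.
  have uj : U w j1 = U w j + (- fl i0 (U w j)) * n by rewrite U_per.
  have k2 : fl a (U w k1) = 0 by rewrite uk fl_per; lia.
  have k3 : fl i0 (U w k1) = -1 by rewrite uk fl_per; move: hk; rewrite /pa; lia.
  have j2 : fl i0 (U w j1) = 0 by rewrite uj fl_per; lia.
  have j3 : fl a' (U w j1) = -1 by rewrite uj fl_per; move: hj; rewrite /pb; lia.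
  have [b1 b2] := fl_bounds a (U w k1); have [b3 b4] := fl_bounds i0 (U w k1).
  have [b5 b6] := fl_bounds i0 (U w j1); have [b7 b8] := fl_bounds a' (U w j1).
  rewrite k2 in b1 b2; rewrite k3 in b3 b4; rewrite j2 in b5 b6; rewrite j3 in b7 b8.
  have : d w j1 - d w k1 <= 1.
    apply: balanced_all; last by rewrite k3 j2.
    move=> i hi; apply/eqP; rewrite eq_le; apply/andP; split; last by apply: fl_mono; lia.
    rewrite leNgt; apply/negP => hlt; set q := fl i (U w j1) in hlt.
    have c1 : i + q * n <= U w j1 by rewrite -fl_ge.
    have c2 : U w k1 < i + q * n by rewrite ltNge -fl_ge; lia.
    by have := gap _ (J_per q hi) ltac:(lia); lia.
  by rewrite !disp_per.
split.
- move=> t; have hA := A1 t; have hB := B1 t; have [u1 u2 u3] := pab t.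
  have [v1 v2 v3] := pab (U w t); rewrite dA in hA; rewrite dB in hB.
  (* An entry out of range at [t] makes the variation of [pb] (if too small) or [pa] (if too large)
     negative there, hence positive elsewhere; the two places contradict [sep]. *)
  apply/andP; split; rewrite leNgt; apply/negP => hlt.
    have [j hj] := rsum_neg_pos (Upb _ pbp) (US _ pbp) (t := t) ltac:(lia).
    have [x1 x2 x3] := pab j; have [y1 y2 y3] := pab (U w j).
    have hBj := B1 j; rewrite dB in hBj.
    by have := sep j t ltac:(lia) ltac:(lia); lia.
  have [k hk] := rsum_neg_pos (Upb _ pap) (US _ pap) (t := t) ltac:(lia).
  have [x1 x2 x3] := pab k; have [y1 y2 y3] := pab (U w k).
  have hAk := A1 k; rewrite dA in hAk.
  by have := sep t k ltac:(lia) ltac:(lia); lia.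
- by rewrite rsum_D -(rsum_D w a).
case: (classic (exists k, d w k = 0 /\ disp w a k <> 0)) => [[k [k0 ka]]|hn].
  (* Given such a [k], [sep] bounds [d w j] by 1 whenever [pb (U w j) = 1], so the variation of [pb]
     bounds the gain in zeros from [i0] to [a'] from below. *)
  apply: le_trans B3; rewrite -subr_ge0 -rsum_sub -[leLHS](US _ pbp); apply: rsum_le => j.
  have [x1 x2 x3] := pab k; have [y1 y2 y3] := pab (U w k).
  have hAk := A1 k; rewrite dA in ka hAk.
  have hBj := B1 j; have hs := sep j k ltac:(lia).
  have [x4 x5 x6] := pab j; have [y4 y5 y6] := pab (U w j).
  rewrite dB in hBj *.
  case: (eqVneq (pb (U w j)) 1) => [/hs h1|h1]; lia.
apply: le_trans A3; apply: rsum_le => t.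
case: (eqVneq (d w t) 0) => [e|//].
case: (eqVneq (disp w a t) 0) => [//|/eqP e']; by case: hn; exists t.
Qed.

End Balanced.
End Lift.

Lemma perm_at_full s w : level2 w -> (forall i, inI2m [set: 'I_m.+1] i -> perm_at s w i) ->
  forall i, perm_at s w i.
Proof.
move=> hl h i; apply: h; apply/inI2mP.
have hr := resE i; have hlt := ltn_ord (res i); set r := nat_of_ord (res i) in hr hlt.
case: (leqP r m) => hm.
  have hm' : (r < m.+1)%N by [].
  exists (Ordinal hm'); [by rewrite inE | exists (fl 0 i); left; rewrite /=; lia].
have hm' : (m.*2 - r < m.+1)%N by lia.
exists (Ordinal hm'); [by rewrite inE | exists (fl 0 i + 1); right; rewrite /=; lia].
Qed.

(** Induction on the complement of [I]: a balanced representative is permissible at one more index,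
    and the parahoric subgroup of the larger set is contained in that of [I]. *)
Lemma lift_all s (I : {set 'I_m.+1}) w : I != set0 -> inW w ->
  (forall i, inI2m I i -> perm_at s w i) ->
  exists z, [/\ inWI I z, level2 (ewmul w z) & forall i, perm_at s (ewmul w z) i].
Proof.
have [M] := ubnP #|~: I|; elim: M I w => // M IH I w hM I0 hW hp.
have [i1 hi1] := J_ex I0.
case: (set_0Vmem (~: I)) => [e|[a]].
  have hl := perm_at_level2 hW (hp i1 hi1).
  exists (ew1 m); rewrite ewmul1; split=> //; first exact: inWI1.
  apply: perm_at_full => // i hi; apply: hp.
  by rewrite -(setCK I) e setC0.
rewrite inE => haI.
pose i0 := Posz (nat_of_ord a).
have hi0 : 0 <= i0 <= Posz m by have := ltn_ord a; rewrite /i0; lia.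
have I1 : a |: I != set0 by apply/set0Pn; exists a; rewrite !inE eqxx.
have hM1 : (#|~: (a |: I)| < M)%N.
  apply: leq_trans (_ : #|~: I| <= M)%N; last by [].
  apply: proper_card; apply/properP; split.
    by apply/subsetP => x; rewrite !inE negb_or => /andP[].
  by exists a; rewrite !inE ?eqxx.
have sub i : inI2m I i -> inI2m (a |: I) i.
  by move=> [b [hb h]]; exists b; rewrite !inE hb orbT.
have WIsub z : inWI (a |: I) z -> inWI I z.
  by move=> [h1 h2]; split=> // i /sub; apply: h2.
have [z [hz hlz hpz]] : exists z, [/\ inWI I z, level2 (ewmul w z) &
    forall i, inI2m (a |: I) i -> perm_at s (ewmul w z) i].
  have ext z : level2 (ewmul w z) -> (forall i, inI2m I i -> perm_at s (ewmul w z) i) ->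
      perm_at s (ewmul w z) i0 -> forall i, inI2m (a |: I) i -> perm_at s (ewmul w z) i.
    move=> hl h1 h2 i /inI2mP[b]; rewrite !inE => /orP[/eqP->|hb] [q hq].
      case: hq => ->; apply: perm_at_peri => //.
      by have [] := perm_at_opp hl h2.
    by apply: h1; apply/inI2mP; exists b => //; exists q.
  case: (classic (inI2m I i0)) => hJ0.
    have hl := perm_at_level2 hW (hp i1 hi1).
    exists (ew1 m); split; [exact: inWI1 | by rewrite ewmul1 |].
    by apply: ext; rewrite ewmul1 //; apply: hp.
  have [z [h1 h2 h3 h4]] := exists_balanced I0 hi0 hW hp.
  exists z; split=> //; apply: ext => //.
  exact: (balanced_perm_at I0 hi0 hJ0 h2 h3 h4).
have hWz := level2_inW hlz.
have [z' [h1 h2 h3]] := IH (a |: I) _ hM1 I1 hWz hpz.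
exists (ewmul z z'); rewrite ewmulA; split=> //.
by apply: inWI_mul => //; apply: WIsub.
Qed.

Lemma permissible_admissible s (I : {set 'I_m.+1}) w : (s <= m)%N -> I != set0 -> inW w ->
  wedge_permissible s I w -> admissible s I w.
Proof.
move=> hs I0 hW /wedgeP hp.
have [z [hz hl hpz]] := lift_all I0 hW hp.
have [sg [hsg hst]] := steps_translation hs hl hpz.
exists sg; split=> //; apply: (steps_coset_le I0 hW _ hst).
by exists z.
Qed.

End Line.

Theorem theorem6p1p1 (m s : nat) (I : {set 'I_m.+1}) (w : ew m) :
  (0 < m)%N -> (s <= m)%N -> I != set0 -> inW w ->
  (wedge_permissible s I w <-> admissible s I w).
Proof.
move=> Hm hs I0 hW; split; last exact: admissible_permissible.
exact: permissible_admissible.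
Qed.
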